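(* Fix $(k_1,k_2,k_3)\in\mathbb{Z}_{\ge 0}^3$. Let $n$ be a $(k_1,k_2,k_3)$-generalized Markov number, i.e. a positive integer appearing in a positive integer solution $(x,y,z)$ of $x^2+y^2+z^2+k_1yz+k_2zx+k_3xy=(3+k_1+k_2+k_3)xyz$, and let $i\in\{1,2,3\}$ be the position of $n$ in such a solution. Set $\Delta(n,i):=((3+k_1+k_2+k_3)n-k_i)^2-4$. Then there exist a quadratic irrational $\alpha\in\mathbb{Q}(\sqrt{\Delta(n,i)})$ and the quadratic form $Q=(x-\alpha y)(x-\alpha' y)$, where $\alpha'$ is the quadratic conjugate of $\alpha$, such that \[\mathcal L(\alpha)=\mathcal M(Q)=\frac{\sqrt{\Delta(n,i)}}{n}.\] In particular, for every $(k_1,k_2,k_3)\in\mathbb{Z}_{\ge0}^3$, the set \[\mathcal M_{k_1,k_2,k_3}=\left\{\frac{\sqrt{\Delta(n,i)}}{n}\ \middle|\ n \text{ is a } (k_1,k_2,k_3)\text{-generalized Markov number and } i \text{ is the position of } n \text{ in a positive integer solution of the } (k_1,k_2,k_3)\text{-generalized Markov equation}\right\}\] is contained in the Markov-Lagrange spectrum $\mathcal L$, and hence in the Markov spectrum $\mathcal M$.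
   Context: For an irrational $\alpha$, $\mathcal L(\alpha)=\limsup_{q\to\infty}\frac{1}{q\|q\alpha\|}$ (with $\|\cdot\|$ the distance to the nearest integer), and $\mathcal L=\{\mathcal L(\alpha)\mid \alpha\in\mathbb R\setminus\mathbb Q\}$ is the Markov-Lagrange spectrum. For a real indefinite binary quadratic form $Q(x,y)=ax^2+bxy+cy^2$ with discriminant $D=b^2-4ac>0$, $\mathcal M(Q)=\sup_{(x,y)\in\mathbb Z^2\setminus\{0\}}\frac{\sqrt D}{|Q(x,y)|}$, and $\mathcal M=\{\mathcal M(Q)\}$ is the Markov spectrum; it is known that $\mathcal L\subset\mathcal M$. When $k_1=k_2=k_3=0$ the set $\mathcal M_{0,0,0}$ is the classical discrete Markov spectrum $\{\sqrt{9n^2-4}/n \mid n \text{ a Markov number}\}$. *)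

(* Defs.v *)
From HB Require Import structures.
From mathcomp Require Import all_boot all_order all_algebra.
From mathcomp Require Import all_classical all_reals all_analysis.

Set Implicit Arguments.
Unset Strict Implicit.
Unset Printing Implicit Defensive.

Import Order.TTheory GRing.Theory Num.Theory.
Import numFieldNormedType.Exports.

Local Open Scope classical_set_scope.
Local Open Scope ring_scope.

Definition dist_int (R : realType) (x : R) : R :=
  inf [set `|x - m%:~R| | m in [set: int]].

(* Only meant for irrational [alpha]: the denominator then vanishes only at
   q = 0, and one term does not affect the limsup. *)
Definition lagrange_const (R : realType) (alpha : R) : \bar R :=
  limn_esup (fun q : nat => (q%:R * dist_int (q%:R * alpha))^-1%:E).

Definition lagrange_spectrum (R : realType) : set (\bar R) :=
  [set lagrange_const alpha | alpha in @irrational R].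

Record bqform (R : Type) := BQForm { qa : R; qb : R; qc : R }.

Definition qeval (R : realType) (Q : bqform R) (x y : R) : R :=
  qa Q * x ^+ 2 + qb Q * x * y + qc Q * y ^+ 2.

Definition qdisc (R : realType) (Q : bqform R) : R :=
  qb Q ^+ 2 - 4 * qa Q * qc Q.

Definition indefinite (R : realType) (Q : bqform R) : Prop := 0 < qdisc Q.

(* The division is the one of [\bar R], where r / 0 = +oo for r > 0; hence the
   constant is +oo when an indefinite [Q] represents 0 nontrivially. *)
Definition markov_const (R : realType) (Q : bqform R) : \bar R :=
  ereal_sup [set ((Num.sqrt (qdisc Q))%:E / `|qeval Q p.1%:~R p.2%:~R|%:E)%E
            | p in [set p : int * int | p != (0, 0)]].

Definition markov_spectrum (R : realType) : set (\bar R) :=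
  [set markov_const Q | Q in [set Q : bqform R | indefinite Q]].

Definition quadratic_irrational (R : realType) (alpha : R) : Prop :=
  irrational alpha /\
  exists2 p : {poly rat}, size p = 3%N & root (map_poly ratr p) alpha.

(* [alpha] and [alpha'] are the two roots of one irreducible monic quadratic
   polynomial over the rationals. *)
Definition quadratic_conjugate (R : realType) (alpha alpha' : R) : Prop :=
  exists2 p : {poly rat}, irreducible_poly p &
    map_poly ratr p = ('X - alpha%:P) * ('X - alpha'%:P).

(* The field Q(sqrt d) inside [R], for a nonnegative integer [d]. *)
Definition Qsqrt (R : realType) (d : int) : set R :=
  [set x | exists a b : rat, x = ratr a + ratr b * Num.sqrt d%:~R].

Definition gmarkov_solution (k1 k2 k3 x y z : nat) : Prop :=
  [/\ (0 < x)%N, (0 < y)%N, (0 < z)%N &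
   (x ^ 2 + y ^ 2 + z ^ 2 + k1 * y * z + k2 * z * x + k3 * x * y
    = (3 + k1 + k2 + k3) * x * y * z)%N].

(* Positions 1, 2, 3 are the ordinals 0, 1, 2 of ['I_3]. *)
Definition gmarkov_at (k1 k2 k3 n : nat) (i : 'I_3) : Prop :=
  exists x y z : nat,
    gmarkov_solution k1 k2 k3 x y z /\ n = tnth [tuple x; y; z] i.

Definition Delta (k1 k2 k3 n : nat) (i : 'I_3) : int :=
  ((3 + k1 + k2 + k3)%N%:Z * n%:Z - (tnth [tuple k1; k2; k3] i)%:Z) ^+ 2 - 4.

Definition gmarkov_set (R : realType) (k1 k2 k3 : nat) : set R :=
  [set v | exists (n : nat) (i : 'I_3),
     gmarkov_at k1 k2 k3 n i /\ v = Num.sqrt (Delta k1 k2 k3 n i)%:~R / n%:R].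

Arguments lagrange_spectrum R : clear implicits.
Arguments markov_spectrum R : clear implicits.
Arguments gmarkov_set R k1 k2 k3 : clear implicits.

(* Main.v *)
Require Import Defs.
From HB Require Import structures.
From mathcomp Require Import all_boot all_order all_algebra.
From mathcomp Require Import all_classical all_reals all_analysis.
From mathcomp Require Import zify ring.

Set Implicit Arguments.
Unset Strict Implicit.
Unset Printing Implicit Defensive.

Import Order.TTheory GRing.Theory Num.Theory.
Import numFieldNormedType.Exports.

Local Open Scope classical_set_scope.
Local Open Scope ring_scope.

(** Write a solution as (n, a, b), with [k] attached to n, [ka] to a, [kb] to b,
    and put s = 3 + k + ka + kb, t = s n - k.  With u = b / a mod n one has
    u^2 + k u + 1 = 0 mod n, so that f = n x^2 + (t - 2u) xy + c y^2 is integral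
    of discriminant t^2 - 4 = Delta(n, i) for a suitable c.  Since f (1, 0) = n,
    everything reduces to |f| >= n on the nonzero integer vectors: this gives
    M(Q), and the orbit of (1, 0) under the automorph of trace t provides the
    approximations that realise L(alpha).

    Substituting w = u y - n x turns n f into w^2 - t w y + y^2 on the lattice
    of the (w, y) with n | b y - a w.  Geometrically n, a, b are the lambda
    lengths of an ideal triangle with integral cusps e, r, g, where
    det(e, g) = n, det(e, r) = b, det(r, g) = a, and w, y are the determinants
    of an integral vector with e and g.  An element of trace k maps e to g; its
    orbit of e spans an ideal polygon glued to the edge (e, g).  The vectors
    beyond that edge where f > 0 are handled by [edge_bound], which passes from
    the edges a, b to the edge n and hence propagates along the tree of
    solutions from (1, 1, 1).  Those where f < 0 are moved by the automorph
    next to the triangle, where they lie either beyond a polygon glued to a or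
    b, or beyond a translate of the edge n. *)

(** * Vectors across an edge, where the form is positive *)

(* [a * w + b * y = n * x] says that the vector with determinants w and y against
   the ends of the edge n is integral and lies on the other side of that edge
   than the triangle; x is its determinant against the third cusp. *)
Definition edge_bound (s k n a b : int) : Prop :=
  forall w y x : int, 0 < w -> 0 < y -> a * w + b * y = n * x ->
    n ^+ 2 <= w ^+ 2 + y ^+ 2 + (s * n - k) * w * y.

(* For k = 2 the limit points of the polygon glued to the edge n merge into a cusp;
   the corresponding vectors have w = y and are fixed by turning the polygon. *)
Definition cusp_bound (k n a b : int) : Prop :=
  k = 2 -> forall w x : int, 0 < w -> (a + b) * w = n * x -> n <= w ^+ 2.

Lemma edge_boundC (s k n a b : int) :
  edge_bound s k n a b -> edge_bound s k n b a.
Proof.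
move=> E w y x w0 y0 xE; have := E y w x y0 w0; rewrite addrC => /(_ xE); lia.
Qed.

Lemma coprimez_cancel (n a c : int) : coprimez n a ->
  (exists x, a * c = n * x) -> exists x, c = n * x.
Proof.
move=> na [x xE]; have : (n %| a * c)%Z by rewrite xE dvdz_mulr.
by rewrite Gauss_dvdzr // => /dvdzP [q ->]; exists q; rewrite mulrC.
Qed.

Lemma mul_gt0_ge1 (n c : int) : 0 < n -> 0 < n * c -> 1 <= c.
Proof. by move=> n0; rewrite pmulr_rgt0. Qed.

(* Turning the vector around the polygon brings it to the side of the triangle,
   where it is the third cusp (r = 0) or lies beyond the edge a or b. *)
Lemma near_side_bound (s k ka kb n n' a b : int) :
  0 <= k -> 0 <= ka -> 0 <= kb -> 0 < n -> 0 < n' -> 0 < a -> 0 < b -> 0 < s ->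
  n + n' = s * a * b - ka * b - kb * a ->
  n * n' = a ^+ 2 + k * a * b + b ^+ 2 ->
  coprimez n a -> coprimez n b -> coprimez a b ->
  edge_bound s ka a b n -> edge_bound s kb b n a ->
  forall w y x : int, 0 < w -> k * w <= y -> a * w + b * y = n * x ->
    n ^+ 2 <= w ^+ 2 + (y - k * w) ^+ 2 + s * n * w * (y - k * w).
Proof.
move=> k0 ka0 kb0 n0 n'0 a0 b0 s0 sumE prodE na nb ab Ea Eb w y x w0 kwy xE.
set v := y - k * w.
have v0 : 0 <= v by rewrite /v; lia.
(* [r] is the determinant against the third cusp; its sign tells whether the turned vector lies
   beyond the edge a or the edge b. *)
have [r rE] : exists r, b * w - a * v = n * r.
  apply: (coprimez_cancel nb); exists (n' * w - a * x).
  transitivity (n * n' * w - a * (n * x)); last by ring.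
  by rewrite prodE -xE /v; ring.
have snab : n ^+ 2 <= s * n * a * b.
  have -> : s * n * a * b = n * (n + n' + ka * b + kb * a).
    by rewrite sumE; ring.
  rewrite expr2 ler_wpM2l ?ltW //.
  have : 0 <= ka * b by rewrite mulr_ge0 // ltW.
  have : 0 <= kb * a by rewrite mulr_ge0 // ltW.
  lia.
have [v_eq0|vn0] := eqVneq v 0.
  have [c cE] : exists c, w = n * c.
    by apply: (coprimez_cancel nb); exists r; rewrite -rE v_eq0; ring.
  have c1 : 1 <= c by apply: (mul_gt0_ge1 n0); rewrite -cE.
  by rewrite cE v_eq0 expr0n mulr0 !addr0 exprMn ler_peMr ?exprn_ege1 ?sqr_ge0.
have {vn0}v0 : 0 < v by lia.
case: (ltgtP r 0) => r0.
- have := Ea w (- r) v w0; rewrite oppr_gt0 => /(_ r0) Ea'.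
  have {}Ea' := Ea' ltac:(lia).
  have aE : a * v = b * w - n * r by rewrite -rE; ring.
  rewrite -(ler_pM2l (x := a ^+ 2)) ?exprn_gt0 //.
  (* Eliminating [a * v] in favour of [r] exhibits [n ^ 2] times the form of the edge a at
     [(w, - r)]; the remainder has nonnegative terms because of [snab]. *)
  have -> : a ^+ 2 * (w ^+ 2 + v ^+ 2 + s * n * w * v) =
    n ^+ 2 * (w ^+ 2 + (- r) ^+ 2 + (s * a - ka) * w * (- r)) +
    (w ^+ 2 * (a ^+ 2 + b ^+ 2 + (s * n * a * b - n ^+ 2)) +
      w * (- r) * (2 * b * n + ka * n ^+ 2)).
    transitivity ((a * w) ^+ 2 + (a * v) ^+ 2 + s * n * a * w * (a * v)); first by ring.
    by rewrite aE; ring.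
  rewrite [leLHS]mulrC -[leLHS]addr0 lerD //.
    by rewrite ler_wpM2l ?sqr_ge0.
  apply: addr_ge0; apply: mulr_ge0; rewrite ?sqr_ge0 //.
  + by apply: addr_ge0; rewrite ?subr_ge0 // addr_ge0 ?sqr_ge0.
  + by rewrite mulr_ge0 ?oppr_ge0 ?ltW.
  + by rewrite addr_ge0 // !mulr_ge0 ?sqr_ge0 // ltW.
- have := Eb r v w r0 v0 ltac:(lia) => Eb'.
  have bE : b * w = n * r + a * v by rewrite -rE; ring.
  rewrite -(ler_pM2l (x := b ^+ 2)) ?exprn_gt0 //.
  have -> : b ^+ 2 * (w ^+ 2 + v ^+ 2 + s * n * w * v) =
    n ^+ 2 * (r ^+ 2 + v ^+ 2 + (s * b - kb) * r * v) +
    (v ^+ 2 * (a ^+ 2 + b ^+ 2 + (s * n * a * b - n ^+ 2)) +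
      v * r * (2 * a * n + kb * n ^+ 2)).
    transitivity ((b * w) ^+ 2 + (b * v) ^+ 2 + s * n * b * v * (b * w)); first by ring.
    by rewrite bE; ring.
  rewrite [leLHS]mulrC -[leLHS]addr0 lerD //.
    by rewrite ler_wpM2l ?sqr_ge0.
  apply: addr_ge0; apply: mulr_ge0; rewrite ?sqr_ge0 //.
  + by apply: addr_ge0; rewrite ?subr_ge0 // addr_ge0 ?sqr_ge0.
  + by rewrite mulr_ge0 ?ltW.
  + by rewrite addr_ge0 // !mulr_ge0 ?sqr_ge0 // ltW.
- have [c cE] : exists c, w = a * c.
    by apply: (coprimez_cancel ab); exists v; move: rE; rewrite r0; lia.
  have vE : v = b * c.
    by apply: (mulfI (x := a)); [lia | move: rE; rewrite r0 cE; lia].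
  have c1 : 1 <= c by apply: (mul_gt0_ge1 a0); rewrite -cE.
  rewrite cE vE.
  have -> : (a * c) ^+ 2 + (b * c) ^+ 2 + s * n * (a * c) * (b * c) =
    ((a * c) ^+ 2 + (b * c) ^+ 2) + (s * n * a * b) * c ^+ 2 by ring.
  rewrite -[leLHS]add0r lerD ?addr_ge0 ?sqr_ge0 // (le_trans snab) //.
  by rewrite ler_peMr ?exprn_ege1 // !mulr_ge0 // ltW.
Qed.

(** With [v = y - k * w], undoing the turn of [near_side_bound] adds
    [k * w * v + s * n * k * w ^ 2], which is nonnegative. *)
Lemma edge_sector (s k ka kb n n' a b : int) :
  0 <= k -> 0 <= ka -> 0 <= kb -> 0 < n -> 0 < n' -> 0 < a -> 0 < b -> 0 < s ->
  n + n' = s * a * b - ka * b - kb * a ->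
  n * n' = a ^+ 2 + k * a * b + b ^+ 2 ->
  coprimez n a -> coprimez n b -> coprimez a b ->
  edge_bound s ka a b n -> edge_bound s kb b n a ->
  forall w y x : int, 0 < w -> k * w <= y -> a * w + b * y = n * x ->
    n ^+ 2 <= w ^+ 2 + y ^+ 2 + (s * n - k) * w * y.
Proof.
move=> k0 ka0 kb0 n0 n'0 a0 b0 s0 sumE prodE na nb ab Ea Eb w y x w0 kwy xE.
have := near_side_bound k0 ka0 kb0 n0 n'0 a0 b0 s0 sumE prodE na nb ab Ea Eb w0 kwy xE.
have : 0 <= k * w * (y - k * w) by rewrite !mulr_ge0 ?subr_ge0 // ltW.
have : 0 <= s * n * k * w * w by rewrite !mulr_ge0 // ltW.
lia.
Qed.

(** Otherwise [k * w * y >= 2 * y ^ 2], and the form is at most [w ^ 2 - y ^ 2 < 0]. Hence the turn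
    to [(k * w - y, w)] lowers the sum of the coordinates. *)
Lemma edge_descent_lt (k w y : int) :
  2 <= k -> 0 < w -> w < y -> 0 <= w ^+ 2 + y ^+ 2 - k * w * y -> k * w < 2 * y.
Proof.
move=> k2 w0 wy H; rewrite ltNge; apply/negP => le2.
have h1 : y * (2 * y) <= y * (k * w) by rewrite ler_wpM2l //; lia.
have h2 : w * w < y * y by rewrite ltr_pM //; lia.
lia.
Qed.

(* The vectors of the sector between the two limit points of the polygon. *)
Lemma edge_negative (k s n w y j : int) :
  0 < n -> 0 < w -> 0 < y -> k + 3 <= s -> 2 <= k -> 1 <= j ->
  w ^+ 2 + y ^+ 2 - k * w * y = - (n * j) ->
  n ^+ 2 <= w ^+ 2 + y ^+ 2 + (s * n - k) * w * y.
Proof.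
move=> n0 w0 y0 sk k2 j1 HE.
pose p := w * y.
have p1 : 1 <= p by rewrite /p -gtz0_ge1 mulr_gt0.
have sq : 2 * p <= w ^+ 2 + y ^+ 2 by have := sqr_ge0 (w - y); rewrite /p; lia.
have nj : n <= n * j by rewrite ler_peMr // ltW.
have kp : n <= (k - 2) * p by rewrite /p in sq *; lia.
suff : n ^+ 2 <= (s * n - k + 2) * p by rewrite /p in sq *; lia.
have snk : (k + 3) * n - k + 2 <= s * n - k + 2.
  by have : (k + 3) * n <= s * n by [rewrite ler_wpM2r //; lia]; lia.
have base : 0 <= (k + 3) * n - k + 2.
  by have : k * 1 <= k * n by [rewrite ler_wpM2l //; lia]; lia.
(* In the first case the lower bound [kp] on [p] suffices. In the second, k exceeds [5 * n + 2], and
   the coefficient alone is at least [n ^ 2]. *)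
have [big|small] := lerP ((k - 2) * n) (s * n - k + 2).
  have h1 : n * n <= n * ((k - 2) * p) by rewrite ler_wpM2l // ltW.
  have h2 : (k - 2) * n * p <= (s * n - k + 2) * p by rewrite ler_wpM2r //; lia.
  lia.
have k5 : 5 * n + 2 < k by lia.
have h : n * n <= s * n - k + 2.
  have h1 : 0 <= (k - 5 * n) * (n - 1) by rewrite mulr_ge0 //; lia.
  have h2 : 0 <= n * (n - 1) by rewrite mulr_ge0 //; lia.
  lia.
have : (s * n - k + 2) * 1 <= (s * n - k + 2) * p by rewrite ler_wpM2l //; lia.
lia.
Qed.

(** Modulo n one has [a * w = - b * y], so [a ^ 2] times the form is
    [(a ^ 2 + k * a * b + b ^ 2) * y ^ 2], that is 0. *)
Lemma edge_norm_dvd (k n n' a b w y x : int) :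
  n * n' = a ^+ 2 + k * a * b + b ^+ 2 -> coprimez n a ->
  a * w + b * y = n * x -> exists j, w ^+ 2 + y ^+ 2 - k * w * y = n * j.
Proof.
move=> prodE na xE; do 2 apply: (coprimez_cancel na).
exists (n' * y ^+ 2 + (n * x - 2 * b * y - k * a * y) * x).
transitivity (n * n' * y ^+ 2 + (n * x) * (n * x - 2 * b * y - k * a * y)).
  by rewrite prodE -xE; ring.
by ring.
Qed.

(** The turn [(w, y) -> (k * w - y, w)] of the polygon is integral, hence preserves the lattice;
    [edge_rotateV] treats its inverse. *)
Lemma edge_rotate (k n n' a b w y x : int) :
  n * n' = a ^+ 2 + k * a * b + b ^+ 2 -> coprimez n b ->
  a * w + b * y = n * x -> exists z, a * (k * w - y) + b * w = n * z.
Proof.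
move=> prodE nb xE; apply: (coprimez_cancel nb); exists (n' * w - a * x).
transitivity (n * n' * w - a * (n * x)); last by ring.
by rewrite prodE -xE; ring.
Qed.

Lemma edge_rotateV (k n n' a b w y x : int) :
  n * n' = a ^+ 2 + k * a * b + b ^+ 2 -> coprimez n a ->
  a * w + b * y = n * x -> exists z, a * y + b * (k * y - w) = n * z.
Proof.
move=> prodE na xE; apply: (coprimez_cancel na); exists (n' * y - b * x).
transitivity (n * n' * y - b * (n * x)); last by ring.
by rewrite prodE -xE; ring.
Qed.

(** The form is [H + s * n * w * y], where [H = w ^ 2 + y ^ 2 - k * w * y] is fixed by turning the
    polygon. For [H >= 0] and [w != y] a turn in the right direction lowers both [w + y] and
    [w * y], until the vector reaches one of the two outer sectors. The case [w = y] forces k = 2,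
    the cusp. *)
Lemma edge_step (s k ka kb n n' a b : int) :
  0 <= k -> 0 <= ka -> 0 <= kb -> 0 < n -> 0 < n' -> 0 < a -> 0 < b ->
  k + 3 <= s ->
  n + n' = s * a * b - ka * b - kb * a ->
  n * n' = a ^+ 2 + k * a * b + b ^+ 2 ->
  coprimez n a -> coprimez n b -> coprimez a b ->
  edge_bound s ka a b n -> edge_bound s kb b n a -> cusp_bound k n a b ->
  edge_bound s k n a b.
Proof.
move=> k0 ka0 kb0 n0 n'0 a0 b0 sk sumE prodE na nb ab Ea Eb Cn.
have s0 : 0 < s by lia.
suff H (m : nat) (w y x : int) : 0 < w -> 0 < y -> w + y <= m%:Z ->
    a * w + b * y = n * x -> n ^+ 2 <= w ^+ 2 + y ^+ 2 + (s * n - k) * w * y.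
  by move=> w y x w0 y0 xE; apply: (H (absz (w + y)) w y x w0 y0 _ xE); lia.
elim: m w y x => [|m IH] w y x w0 y0 wym xE; first by lia.
have [kwy|ykw] := lerP (k * w) y.
  exact: (edge_sector k0 ka0 kb0 n0 n'0 a0 b0 s0 sumE prodE na nb ab Ea Eb w0 kwy xE).
have [kyw|wky] := lerP (k * y) w.
  have := @edge_sector s k kb ka n n' b a k0 kb0 ka0 n0 n'0 b0 a0 s0.
  have -> : s * b * a - kb * a - ka * b = s * a * b - ka * b - kb * a by ring.
  have -> : b ^+ 2 + k * b * a + a ^+ 2 = a ^+ 2 + k * a * b + b ^+ 2 by ring.
  move=> /(_ sumE prodE nb na); rewrite coprimez_sym => /(_ ab).
  move=> /(_ (edge_boundC Eb) (edge_boundC Ea) y w x y0 kyw).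
  by rewrite addrC => /(_ xE); lia.
have k2 : 2 <= k.
  rewrite leNgt; apply/negP => k1.
  have [k_0|k_1] : k = 0 \/ k = 1 by lia.
    by move: ykw; rewrite k_0 mul0r; lia.
  by move: ykw wky; rewrite k_1 !mul1r; lia.
pose H := w ^+ 2 + y ^+ 2 - k * w * y.
case: (ltP H 0) => H0.
  have [j jE] := edge_norm_dvd prodE na xE; rewrite -/H in jE.
  have j0 : 1 <= - j.
    by apply: (mul_gt0_ge1 n0); rewrite mulrN -jE oppr_gt0.
  by apply: (edge_negative n0 w0 y0 sk k2 j0); rewrite mulrN opprK -jE.
case: (ltgtP w y) => wy.
- have lt2 := edge_descent_lt k2 w0 wy H0.
  have [z zE] := edge_rotate prodE nb xE.
  have := IH (k * w - y) w z ltac:(lia) w0 ltac:(lia) zE.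
  have : 0 <= s * n * (w * (2 * y - k * w)) by rewrite !mulr_ge0 //; lia.
  lia.
- have lt2 : k * y < 2 * w by apply: edge_descent_lt => //; rewrite /H in H0; lia.
  have [z zE] := edge_rotateV prodE na xE.
  have := IH y (k * y - w) z y0 ltac:(lia) ltac:(lia) zE.
  have : 0 <= s * n * (y * (2 * w - k * y)) by rewrite !mulr_ge0 //; lia.
  lia.
have k_2 : k = 2.
  have : 0 <= (2 - k) * w ^+ 2 by rewrite /H -wy in H0; lia.
  by rewrite pmulr_lge0 ?exprn_gt0 //; lia.
have nw : n <= w ^+ 2 by apply: (Cn k_2 w x w0); rewrite -xE -wy; ring.
rewrite -wy k_2.
have h1 : n * n <= n * w ^+ 2 by rewrite ler_wpM2l // ltW.
have h2 : n * w ^+ 2 <= s * (n * w ^+ 2).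
  by rewrite ler_peMl ?mulr_ge0 ?sqr_ge0 //; lia.
lia.
Qed.

(** * Generalized Markov triples and Vieta descent *)

Definition gm_triple (s k ka kb n a b : int) : Prop :=
  [/\ [/\ 0 <= k, 0 <= ka, 0 <= kb & s = 3 + k + ka + kb],
      [/\ 0 < n, 0 < a & 0 < b] &
      n ^+ 2 + a ^+ 2 + b ^+ 2 + k * a * b + ka * b * n + kb * n * a =
      s * n * a * b].

Definition good_triple (s k ka kb n a b : int) : Prop :=
  [/\ [/\ coprimez n a, coprimez n b & coprimez a b],
      [/\ edge_bound s k n a b, edge_bound s ka a b n & edge_bound s kb b n a] &
      [/\ cusp_bound k n a b, cusp_bound ka a b n & cusp_bound kb b n a]].

Lemma gm_triple_rot (s k ka kb n a b : int) :
  gm_triple s k ka kb n a b -> gm_triple s ka kb k a b n.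
Proof. by case=> [[k0 ka0 kb0 sE] [n0 a0 b0] E]; split; [split|split|]; lia. Qed.

Lemma gm_triple_swap (s k ka kb n a b : int) :
  gm_triple s k ka kb n a b -> gm_triple s k kb ka n b a.
Proof. by case=> [[k0 ka0 kb0 sE] [n0 a0 b0] E]; split; [split|split|]; lia. Qed.

Lemma good_triple_rot (s k ka kb n a b : int) :
  good_triple s k ka kb n a b -> good_triple s ka kb k a b n.
Proof. by case=> [[na nb ab] [En Ea Eb] [Cn Ca Cb]]; split; split; rewrite // coprimez_sym. Qed.

Lemma gm_triple_vieta (s k ka kb n a b : int) :
  gm_triple s k ka kb n a b -> exists n',
    [/\ gm_triple s k ka kb n' a b, 0 < n',
        n + n' = s * a * b - ka * b - kb * a &
        n * n' = a ^+ 2 + k * a * b + b ^+ 2].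
Proof.
case=> [[k0 ka0 kb0 sE] [n0 a0 b0] E].
pose n' := s * a * b - ka * b - kb * a - n.
have prodE : n * n' = a ^+ 2 + k * a * b + b ^+ 2 by rewrite /n'; lia.
have n'0 : 0 < n'.
  rewrite -(pmulr_rgt0 _ n0) prodE ltr_wpDl ?exprn_gt0 //.
  by rewrite addr_ge0 ?sqr_ge0 // !mulr_ge0 // ltW.
exists n'; split=> //; last by rewrite /n'; ring.
split=> //; move: prodE; rewrite /n'; lia.
Qed.

(** The monic quadratic with roots n and n' is nonpositive at a, so a separates the roots. If n = a,
    it vanishes there, and so does each term of [gE], which forces b = 1 and [a ^ 2 = b]. *)
Lemma vieta_lt (s k ka kb n n' a b : int) :
  0 <= k -> 0 <= ka -> 0 <= kb -> s = 3 + k + ka + kb ->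
  0 < b -> b <= a -> a <= n ->
  n + n' = s * a * b - ka * b - kb * a ->
  n * n' = a ^+ 2 + k * a * b + b ^+ 2 ->
  n' < n \/ [/\ n = 1, a = 1 & b = 1].
Proof.
move=> k0 ka0 kb0 sE b0 ba an sumE prodE.
have gE : (n - a) * (n' - a) = - (a ^+ 2 * (2 + kb) * (b - 1) +
    a * (a - 1) * b * (ka + k) + b * (a ^+ 2 - b)).
  transitivity (n * n' - (n + n') * a + a ^+ 2); first by ring.
  by rewrite prodE sumE sE; ring.
have a0 : 0 < a by lia.
have t1 : 0 <= a ^+ 2 * (2 + kb) * (b - 1) by rewrite !mulr_ge0 ?sqr_ge0 //; lia.
have t2 : 0 <= a * (a - 1) * b * (ka + k) by rewrite !mulr_ge0 //; lia.
have ab2 : b <= a * b by rewrite ler_peMl //; lia.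
have aab : a * b <= a * a by rewrite ler_wpM2l //; lia.
have t3 : 0 <= b * (a ^+ 2 - b) by rewrite mulr_ge0 //; lia.
have [ltan|lena] := ltrP a n; last first.
  right; have nE : n = a by lia.
  have z : (n - a) * (n' - a) = 0 by rewrite nE subrr mul0r.
  have b2 : b * (a ^+ 2 - b) = 0 by lia.
  have {}b2 : a ^+ 2 = b.
    by move/eqP: b2; rewrite mulf_eq0; lia.
  have b1 : a ^+ 2 * (2 + kb) * (b - 1) = 0 by lia.
  have {}b1 : b = 1.
    move/eqP: b1; rewrite !mulf_eq0; lia.
  have a1 : a = 1 by move: ab2 aab; rewrite b1 in b2 *; lia.
  by split; lia.
left; have : (n - a) * (n' - a) <= 0 by lia.
by rewrite pmulr_rle0 ?subr_gt0 //; lia.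
Qed.

Lemma gm_vieta_lt (s k ka kb n n' a b : int) :
  gm_triple s k ka kb n a b -> a <= n -> b <= n ->
  n + n' = s * a * b - ka * b - kb * a ->
  n * n' = a ^+ 2 + k * a * b + b ^+ 2 ->
  n' < n \/ [/\ n = 1, a = 1 & b = 1].
Proof.
case=> [[k0 ka0 kb0 sE] [n0 a0 b0] _] an bn sumE prodE.
case: (lerP b a) => ab; first exact: (vieta_lt k0 ka0 kb0 sE b0 ab an sumE prodE).
have [||||[]] := @vieta_lt s k kb ka n n' b a k0 kb0 ka0 _ a0 (ltW ab) bn.
- by lia.
- by lia.
- by lia.
- by left.
- by right.
Qed.

(** The edges a and b are shared: [n * n'] is [b ^ 2] modulo a and [a ^ 2] modulo b, so exchanging
    [w] and [y] matches the two lattices, and the forms are symmetric. Only the edge n is new, and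
    [edge_step] supplies it. *)
Lemma good_triple_flip (s k ka kb n n' a b : int) :
  gm_triple s k ka kb n a b -> 0 < n' ->
  n + n' = s * a * b - ka * b - kb * a ->
  n * n' = a ^+ 2 + k * a * b + b ^+ 2 ->
  good_triple s k ka kb n' a b -> good_triple s k ka kb n a b.
Proof.
case=> [[k0 ka0 kb0 sE] [n0 a0 b0] _] n'0 sumE prodE.
case=> [[na' nb' ab] [En' Ea' Eb'] [Cn' Ca' Cb']].
have na : coprimez n a.
  have : coprimez a (n * n').
    rewrite prodE; have -> : a ^+ 2 + k * a * b + b ^+ 2 = (a + k * b) * a + b ^+ 2 by ring.
    by rewrite /coprimez gcdzMDl -/(coprimez _ _) coprimezXr.
  by rewrite coprimezMr coprimez_sym => /andP[].
have nb : coprimez n b.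
  have : coprimez b (n * n').
    rewrite prodE; have -> : a ^+ 2 + k * a * b + b ^+ 2 = (b + k * a) * b + a ^+ 2 by ring.
    by rewrite /coprimez gcdzMDl -/(coprimez _ _) coprimezXr // coprimez_sym.
  by rewrite coprimezMr coprimez_sym => /andP[].
have Ea : edge_bound s ka a b n.
  move=> w y x w0 y0 xE.
  have [z zE] : exists z, b * y + n' * w = a * z.
    apply: (coprimez_cancel ab); exists (n' * x - (a + k * b) * y).
    transitivity (n' * (a * x) - (a + k * b) * a * y); last by ring.
    rewrite -xE; transitivity (b * n' * w + n * n' * y - (a + k * b) * a * y).
      by rewrite prodE; ring.
    by ring.
  by have := Ea' y w z y0 w0 zE; lia.
have Eb : edge_bound s kb b n a.
  move=> w y x w0 y0 xE.
  have ba : coprimez b a by rewrite coprimez_sym.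
  have [z zE] : exists z, n' * y + a * w = b * z.
    apply: (coprimez_cancel ba); exists (n' * x - (b + k * a) * w).
    transitivity (n' * (b * x) - (b + k * a) * b * w); last by ring.
    rewrite -xE; transitivity (a * n' * y + n * n' * w - (b + k * a) * b * w).
      by rewrite prodE; ring.
    by ring.
  by have := Eb' y w z y0 w0 zE; lia.
have Ca : cusp_bound ka a b n.
  move=> ka2 w x w0 xE.
  (* For [ka = 2] the numbers [b + n] and [b + n'] add up to [a * (s * b - kb)], so the divisibility
     passes from one to the other. *)
  apply: (Ca' ka2 w ((s * b - kb) * w - x) w0).
  have n'E : n' = s * a * b - ka * b - kb * a - n by rewrite -sumE; ring.
  by rewrite mulrBr -xE n'E ka2; ring.
have Cb : cusp_bound kb b n a.
  move=> kb2 w x w0 xE.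
  apply: (Cb' kb2 w ((s * a - ka) * w - x) w0).
  have n'E : n' = s * a * b - ka * b - kb * a - n by rewrite -sumE; ring.
  by rewrite mulrBr -xE n'E kb2; ring.
have Cn : cusp_bound k n a b.
  move=> k2 w x w0 xE.
  (* Since [n * n'] is a square here, exchanging [w] and [x] turns the cusp condition for n into
     that for n', with [n' * w ^ 2 = n * x ^ 2]. *)
  have sqE : n * n' = (a + b) ^+ 2 by rewrite prodE k2; ring.
  have x0 : 0 < x by rewrite -(pmulr_rgt0 _ n0) -xE mulr_gt0 ?addr_gt0.
  have xE' : (a + b) * x = n' * w.
    apply: (mulfI (x := n)); first by rewrite gt_eqF.
    by rewrite mulrCA -xE !mulrA -expr2 -sqE.
  have n'x := Cn' k2 x w x0 xE'.
  rewrite -(ler_pM2l n'0) [leLHS]mulrC.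
  have -> : n' * w ^+ 2 = n * x ^+ 2; last by rewrite ler_pM2l.
  apply: (mulfI (x := n)); first by rewrite gt_eqF.
  by rewrite mulrA sqE -exprMn xE; ring.
split=> //; split=> //.
apply: (edge_step k0 ka0 kb0 n0 n'0 a0 b0 _ sumE prodE) => //; lia.
Qed.

Lemma good_triple111 (s k ka kb : int) :
  s = 3 + k + ka + kb -> 0 <= k -> 0 <= ka -> 0 <= kb ->
  good_triple s k ka kb 1 1 1.
Proof.
move=> sE k0 ka0 kb0.
have E1 c : c <= s -> edge_bound s c 1 1 1.
  move=> cs w y _ w0 y0 _; rewrite expr1n mulr1.
  have : 1 <= w ^+ 2 by rewrite exprn_ege1.
  have : 0 <= y ^+ 2 by apply: sqr_ge0.
  have : 0 <= (s - c) * w * y by rewrite !mulr_ge0 ?subr_ge0 // ltW.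
  lia.
have C1 c : cusp_bound c 1 1 1 by move=> _ w _ w0 _; rewrite exprn_ege1.
by split; split; rewrite ?coprimez1 ?coprime1z //; apply: E1; lia.
Qed.

(** Induction on the sum of the entries: a rotation brings the largest entry to the front, where the
    Vieta jump lowers it. *)
Lemma good_tripleP (s k ka kb n a b : int) :
  gm_triple s k ka kb n a b -> good_triple s k ka kb n a b.
Proof.
suff H (m : nat) : forall k ka kb n a b : int, gm_triple s k ka kb n a b ->
    n + a + b <= m%:Z -> good_triple s k ka kb n a b.
  by move=> T; apply: (H (absz (n + a + b))) => //; lia.
elim: m => [|m IH] {}k {}ka {}kb {}n {}a {}b.
  by case=> [_ [n0 a0 b0] _]; lia.
have top k' ka' kb' n' a' b' : gm_triple s k' ka' kb' n' a' b' ->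
    n' + a' + b' <= m.+1%:Z -> a' <= n' -> b' <= n' ->
    good_triple s k' ka' kb' n' a' b'.
  move=> T le an bn; have [n2 [T2 n20 sumE prodE]] := gm_triple_vieta T.
  have [lt|[-> -> ->]] := gm_vieta_lt T an bn sumE prodE; last first.
    by case: T => [[? ? ? ?] _ _]; apply: good_triple111.
  by apply: (good_triple_flip T n20 sumE prodE); apply: (IH _ _ _ _ _ _ T2); lia.
move=> T le.
have [/andP[an bn]|nmax] := boolP ((a <= n) && (b <= n)); first exact: top.
have [/andP[ba na]|amax] := boolP ((b <= a) && (n <= a)).
  do 2 apply: good_triple_rot; apply: top => //; last by lia.
  exact: gm_triple_rot.
apply: good_triple_rot; apply: top; try lia.
by do 2 apply: gm_triple_rot.
Qed.

(** Vieta jumps at the larger of the other two entries keep n and are repeated as long as that entry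
    exceeds n. The bound on negative values uses the maximality of n. *)
Lemma gm_triple_max (s k ka kb n a b : int) :
  gm_triple s k ka kb n a b ->
  exists a' b', gm_triple s k ka kb n a' b' /\ (n = 1 \/ a' <= n /\ b' <= n).
Proof.
suff H (m : nat) : forall ka kb a b : int, gm_triple s k ka kb n a b ->
    a + b <= m%:Z ->
    exists a' b', gm_triple s k ka kb n a' b' /\ (n = 1 \/ a' <= n /\ b' <= n).
  by move=> T; apply: (H (absz (a + b)) _ _ a b) => //; case: T => [_ []]; lia.
elim: m => [|m IH] {}ka {}kb {}a {}b; first by case=> [_ [n0 a0 b0] _]; lia.
wlog ba : ka kb a b / b <= a.
  move=> W T le; case: (lerP b a) => ba; first by apply: (W ka kb a b).
  have {}le : b + a <= m.+1%:Z by rewrite addrC.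
  have [a' [b' [T' P]]] := W kb ka b a (ltW ba) (gm_triple_swap T) le.
  exists b', a'; split; first exact: gm_triple_swap T'.
  by case: P => [?|[? ?]]; [left|right].
move=> T le.
have [an|na] := lerP a n; first by exists a, b; split=> //; right; lia.
have T1 := gm_triple_rot T.
have [a2 [T2 a20 sumE prodE]] := gm_triple_vieta T1.
have [lt|[a1 _ _]] := gm_vieta_lt T1 ba (ltW na) sumE prodE; last first.
  by case: T => [_ [n0 _ _] _]; lia.
by apply: (IH _ _ a2 b); [do 2 apply: gm_triple_rot | lia].
Qed.

(** * Vectors at which the form is negative *)

(* Here p and q are the determinants against e and r, so q <= m * p confines the
   vector to the polygon glued to the edge b, away from its sides through e.  The
   right-hand side is - b^2 f. *)
Lemma polygon_core (s k ka m n a b p q y : int) :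
  gm_triple s k ka m n a b -> a <= n -> b <= n ->
  0 < p -> 0 <= q -> q <= m * p -> n * q + a * p = b * y ->
  n * b ^+ 2 <= (n + ka * b + m * a) * p ^+ 2 +
                (s * n * b - k * b - 2 * a) * p * q - n * q ^+ 2.
Proof.
move=> T an bn p0 q0 qmp yE.
have [[na nb ab] [En Ea Eb] [Cn Ca Cb]] := good_tripleP T.
have Tb := gm_triple_rot (gm_triple_rot T).
have [b' [_ b'0 sumE prodE]] := gm_triple_vieta Tb.
case: T => [[k0 ka0 m0 sE] [n0 a0 b0] _].
have s0 : 0 < s by lia.
have bn' : coprimez b n by rewrite coprimez_sym.
have ba : coprimez b a by rewrite coprimez_sym.
pose e := (ka * b + m * a) * p ^+ 2.
pose d := s * n * b - k * b - m * n - 2 * a.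
have e0 : 0 <= e by rewrite /e mulr_ge0 ?sqr_ge0 // addr_ge0 // mulr_ge0 // ltW.
have nbn : n <= n * b by rewrite ler_peMr // ltW.
have dE : n * b <= d.
  have h1 : 0 <= k * b * (n - 1) by rewrite !mulr_ge0 //; lia.
  have h2 : 0 <= m * n * (b - 1) by rewrite !mulr_ge0 //; lia.
  have h3 : 0 <= ka * n * b by rewrite !mulr_ge0 //; lia.
  rewrite /d sE; lia.
have d0 : 0 <= d by apply: le_trans dE; rewrite mulr_ge0 // ltW.
(* Inside the polygon every summand is nonnegative. If [p >= b] the first one suffices, and if
   [q >= b] the last one does, because [d >= n * b]. *)
rewrite [leRHS](_ : _ =
    n * p ^+ 2 + e + n * (q * (m * p - q)) + d * (p * q)); last first.
  by rewrite /e /d; ring.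
have qq : 0 <= n * (q * (m * p - q)) by rewrite !mulr_ge0 //; lia.
have nb0 : 0 <= n * b by rewrite mulr_ge0 // ltW.
have dpq : n * b * (p * q) <= d * (p * q).
  by rewrite ler_wpM2r // mulr_ge0 // ltW.
have pq0 : 0 <= n * b * (p * q) by rewrite !mulr_ge0 // ltW.
have [bp|pb] := lerP b p.
  have : n * b ^+ 2 <= n * p ^+ 2.
    by rewrite ler_pM2l // ler_pXn2r // nnegrE ltW.
  by clear -e0 qq dpq pq0; lia.
have [bq|qb] := lerP b q.
  have h1 : n * b * b <= n * b * (p * q).
    by rewrite ler_wpM2l // (le_trans bq) // ler_peMl.
  have : 0 <= n * p ^+ 2 by rewrite mulr_ge0 ?sqr_ge0 // ltW.
  by clear -e0 qq dpq pq0 h1; lia.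
have [q_0|qn0] := eqVneq q 0.
  have [c cE] : exists c, p = b * c.
    by apply: (coprimez_cancel ba); exists y; rewrite -yE q_0; ring.
  have c1 : 1 <= c by apply: (mul_gt0_ge1 b0); rewrite -cE.
  have : b * 1 <= b * c by rewrite ler_pM2l.
  by rewrite -cE mulr1 leNgt pb.
have {qn0}q0 : 0 < q by rewrite lt_def qn0.
have m1 : 1 <= m.
  have : 0 < m * p by apply: lt_le_trans qmp.
  by rewrite pmulr_lgt0.
pose g := k * b + 2 * a.
have g0 : 0 <= g by rewrite /g addr_ge0 ?mulr_ge0 // ltW.
have gn : g <= (k + 2) * n.
  have : k * b <= k * n by rewrite ler_wpM2l.
  by rewrite /g; clear -an; lia.
have gb c : c < b -> g * c <= (k + 2) * (n * b).
  move=> cb; have h1 : g * c <= g * b by rewrite ler_wpM2l // ltW.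
  have h2 : g * b <= (k + 2) * n * b by rewrite ler_wpM2r // ltW.
  by clear -h1 h2; lia.
have snb : (3 + k + m) * (n * b) <= s * (n * b).
  by rewrite ler_wpM2r // sE; clear -ka0; lia.
(* From here on the cases are those of [edge_step] for the edge b with the vector [(q, p)]; [p < b]
   excludes that b divides p. *)
have [mqp|pmq] := lerP (m * q) p.
  have N := near_side_bound m0 k0 ka0 b0 b'0 n0 a0 s0 sumE prodE bn' ba na En Ea
    q0 mqp yE.
  have {}N : n * b ^+ 2 <=
      n * (q ^+ 2 + (p - m * q) ^+ 2 + s * b * q * (p - m * q)).
    by rewrite ler_pM2l.
  apply: (le_trans N); rewrite -subr_ge0.
  have -> : n * p ^+ 2 + e + n * (q * (m * p - q)) + d * (p * q) -
      n * (q ^+ 2 + (p - m * q) ^+ 2 + s * b * q * (p - m * q)) =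
      e + 2 * (m * n * p * q) +
      q * ((s * (n * b) * m - n * (m ^+ 2 + 2)) * q - g * p).
    by rewrite /d /g; ring.
  have gp := gb p pb.
  have c0 : (k + 2) * (n * b) <= s * (n * b) * m - n * (m ^+ 2 + 2).
    have h1 : (3 + k + m) * (n * b) * m <= s * (n * b) * m.
      by rewrite ler_wpM2r.
    have h2 : 0 <= (3 + k) * (n * b) * (m - 1).
      by rewrite !mulr_ge0 ?subr_ge0 //; clear -k0 n0 b0; lia.
    have h3 : 0 <= n * m ^+ 2 * (b - 1).
      by rewrite !mulr_ge0 ?sqr_ge0 ?subr_ge0 // ltW.
    have h4 : 0 <= n * (b - 2).
      by rewrite mulr_ge0; [|rewrite ltW|clear -p0 pb; lia].
    by clear -h1 h2 h3 h4; lia.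
  have kb0 : 0 <= (k + 2) * (n * b) by rewrite mulr_ge0; [| clear -k0; lia|].
  rewrite addr_ge0 //.
    by rewrite addr_ge0 // !mulr_ge0 // ltW.
  rewrite mulr_ge0 //; first exact: ltW.
  by rewrite subr_ge0 (le_trans gp) // (le_trans c0) // ler_peMr // (le_trans kb0).
have m2 : 2 <= m.
  rewrite ltNge in pmq; rewrite leNgt; apply/negP => m2.
  have m_1 : m = 1 by clear -m1 m2; lia.
  by rewrite m_1 !mul1r in pmq qmp; rewrite qmp in pmq.
pose H := p ^+ 2 + q ^+ 2 - m * p * q.
have HE : q ^+ 2 + p ^+ 2 - m * q * p = H by rewrite /H; ring.
have dH : n * p ^+ 2 + e + n * (q * (m * p - q)) + d * (p * q) =
    2 * (n * p ^+ 2) + e - n * H + d * (p * q) by rewrite /H; ring.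
have np0 : 0 <= n * p ^+ 2 by rewrite mulr_ge0 ?sqr_ge0 // ltW.
(* For [H < 0] divisibility gives [- H >= b], while [- H <= (m - 2) * (p * q)]. The claim is proved
   after multiplication by [m - 2], so that both bounds apply to [d * (p * q) - n * H]. *)
case: (ltP H 0) => H0.
  have [j jE] := edge_norm_dvd prodE bn' yE; rewrite HE in jE.
  have j1 : 1 <= - j by apply: (mul_gt0_ge1 b0); rewrite mulrN -jE oppr_gt0.
  have bj : b <= - H by rewrite jE -mulrN ler_peMr // ltW.
  have sq : 2 * (p * q) <= p ^+ 2 + q ^+ 2 by have := sqr_ge0 (p - q); clear; lia.
  have Hpq : - H <= (m - 2) * (p * q) by rewrite /H; clear -sq; lia.
  have m3 : 0 < m - 2.
    have : 0 < (m - 2) * (p * q) by apply: lt_le_trans Hpq; rewrite oppr_gt0.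
    by rewrite pmulr_lgt0 // mulr_gt0.
  have d1 : (m - 2) * (n * b) <= (m - 2) * n + d.
    have h : 0 <= (5 + k) * n * (b - 1).
      by rewrite !mulr_ge0 ?subr_ge0; [| |clear -k0; lia|rewrite ltW|].
    have -> : d = s * (n * b) - m * n - g by rewrite /d /g; ring.
    by clear -h snb gn n0; lia.
  have h1 : b * ((m - 2) * (n * b)) <= b * ((m - 2) * n + d).
    by rewrite ler_wpM2l // ltW.
  have h2 : (m - 2) * n * b <= (m - 2) * n * (- H).
    by rewrite ler_wpM2l // mulr_ge0 // ltW.
  have h3 : d * b <= d * ((m - 2) * (p * q)).
    by rewrite ler_wpM2l // (le_trans bj).
  have h4 : (m - 2) * (n * b ^+ 2) <= (m - 2) * (d * (p * q) - n * H).
    by clear -h1 h2 h3; lia.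
  rewrite ler_pM2l // in h4.
  by rewrite dH; clear -h4 np0 e0; lia.
case: (ltgtP p q) => pq.
(* One turn gives a vector to which [Eb] applies; the excess over n times its form is nonnegative
   since [g * q] is controlled by [gb]. *)
- have lt2 : m * p < 2 * q by apply: edge_descent_lt.
  have [z zE] := edge_rotateV prodE bn' yE.
  have [qE|qE] := eqVneq q (m * p).
    have [c cE] : exists c, p = b * c.
      by apply: (coprimez_cancel bn'); exists z; rewrite -zE qE; ring.
    have c1 : 1 <= c by apply: (mul_gt0_ge1 b0); rewrite -cE.
    have : b * 1 <= b * c by rewrite ler_pM2l.
    by rewrite -cE mulr1 leNgt pb.
  have mpq : 0 < m * p - q by rewrite subr_gt0 lt_def eq_sym qE.
  have := Eb p (m * p - q) z p0 mpq zE.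
  rewrite -(ler_pM2l n0) => N; apply: (le_trans N); rewrite -subr_ge0 dH.
  have -> : 2 * (n * p ^+ 2) + e - n * H + d * (p * q) -
      n * (p ^+ 2 + (m * p - q) ^+ 2 + (s * b - m) * p * (m * p - q)) =
      e + 2 * (n * (q * (m * p - q))) +
      p * (s * (n * b) * (2 * q - m * p) - m * n * q - g * q).
    by rewrite /H /d /g; ring.
  rewrite addr_ge0 //; first by rewrite addr_ge0 // mulr_ge0.
  rewrite mulr_ge0 //; first exact: ltW.
  have gq := gb q qb.
  have h1 : m * n * q <= m * n * b by rewrite ler_wpM2l ?(ltW qb) // mulr_ge0 // ltW.
  have h2 : s * (n * b) * 1 <= s * (n * b) * (2 * q - m * p).
    by rewrite ler_wpM2l ?mulr_ge0 ?(ltW s0) ?(ltW n0) ?(ltW b0) //; clear -lt2; lia.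
  by clear -gq h1 h2 snb nb0; lia.
- have lt2 : m * q < 2 * p by apply: edge_descent_lt => //; rewrite HE.
  have [z zE] := edge_rotate prodE ba yE.
  have mqp : 0 < m * q - p by rewrite subr_gt0.
  have := Eb (m * q - p) q z mqp q0 zE.
  rewrite -(ler_pM2l n0) => N; apply: (le_trans N); rewrite -subr_ge0 dH.
  have -> : 2 * (n * p ^+ 2) + e - n * H + d * (p * q) -
      n * ((m * q - p) ^+ 2 + q ^+ 2 + (s * b - m) * (m * q - p) * q) =
      e + q * (s * (n * b) * (2 * p - m * q) + n * (m * p - 2 * q) - g * p).
    by rewrite /H /d /g; ring.
  rewrite addr_ge0 // mulr_ge0 //; first exact: ltW.
  have gp := gb p pb.
  have h1 : 0 <= n * (m * p - 2 * q).
    have h0 : 2 * p <= m * p by rewrite ler_wpM2r // ltW.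
    by rewrite mulr_ge0 ?(ltW n0) //; clear -pq h0; lia.
  have h2 : s * (n * b) * 1 <= s * (n * b) * (2 * p - m * q).
    by rewrite ler_wpM2l ?mulr_ge0 ?(ltW s0) ?(ltW n0) ?(ltW b0) //; clear -lt2; lia.
  by clear -gp h1 h2 snb nb0 m0; lia.
have m_2 : m = 2.
  have : 0 <= (2 - m) * p ^+ 2.
    by rewrite /H -pq in H0; clear -H0; lia.
  by rewrite pmulr_lge0 ?exprn_gt0 //; clear -m2; lia.
have bp : b <= p ^+ 2 by apply: (Cb m_2 p y p0); rewrite -yE -pq; ring.
rewrite /e /d -pq m_2 [leRHS](_ : _ = (ka * b + b * (s * n - k)) * p ^+ 2); last by ring.
have sn : n <= s * n - k.
  have h1 : (3 + k) * n <= s * n.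
    by rewrite ler_wpM2r ?(ltW n0) // sE; clear -ka0 m0; lia.
  have h2 : 0 <= k * (n - 1) by rewrite mulr_ge0 // subr_ge0.
  by clear -h1 h2 n0; lia.
have h1 : n * b * b <= n * b * p ^+ 2 by rewrite ler_wpM2l.
have h2 : b * n <= ka * b + b * (s * n - k).
  have : b * n <= b * (s * n - k) by rewrite ler_pM2l.
  have : 0 <= ka * b by rewrite mulr_ge0 // ltW.
  by clear; lia.
have h3 : b * n * p ^+ 2 <= (ka * b + b * (s * n - k)) * p ^+ 2.
  by rewrite ler_wpM2r ?sqr_ge0.
by clear -h1 h3; lia.
Qed.

(** This is [polygon_core] with [p = w], in the coordinates of the edge n; after scaling, the two
    expressions differ by [w ^ 2] times the Markov equation. *)
Lemma polygon_bound (s k ka kb n a b w y q : int) :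
  gm_triple s k ka kb n a b -> a <= n -> b <= n ->
  0 < w -> 0 <= q -> q <= kb * w -> b * y = n * q + a * w ->
  n ^+ 2 <= (s * n - k) * w * y - w ^+ 2 - y ^+ 2.
Proof.
move=> T an bn w0 q0 qw yE.
have := polygon_core T an bn w0 q0 qw (esym yE).
case: T => [_ [n0 a0 b0] E].
move=> core; rewrite -(ler_pM2l (x := b ^+ 2)) ?exprn_gt0 //.
have -> : b ^+ 2 * n ^+ 2 = n * (n * b ^+ 2) by ring.
rewrite -(ler_pM2l n0) in core; apply: (le_trans core).
have -> : b ^+ 2 * ((s * n - k) * w * y - w ^+ 2 - y ^+ 2) =
    (s * n - k) * b * w * (b * y) - (b * w) ^+ 2 - (b * y) ^+ 2 by ring.
rewrite yE -subr_ge0 [leRHS](_ : _ = w ^+ 2 * (s * n * a * b -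
  (n ^+ 2 + a ^+ 2 + b ^+ 2 + k * a * b + ka * b * n + kb * n * a))).
  by rewrite E subrr mulr0.
by ring.
Qed.

(* The cone spanned by the cusps (a, b') and (b, a + kb * n) in (w, y)-coordinates:
   they span an edge of type n, on which - f dominates the form of [edge_bound]. *)
Lemma opposite_edge_bound (s k ka kb n a b b' w y p q : int) :
  gm_triple s k ka kb n a b -> 0 < b' ->
  b + b' = s * n * a - k * a - ka * n ->
  b * b' = n ^+ 2 + kb * n * a + a ^+ 2 ->
  0 < w -> 0 <= p -> 0 <= q ->
  n * q = b * y - (a + kb * n) * w -> n * p = b' * w - a * y ->
  n ^+ 2 <= (s * n - k) * w * y - w ^+ 2 - y ^+ 2.
Proof.
move=> T b'0 sumE prodE w0 p0 q0 qE pE.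
have [[na nb _] [En _ _] _] := good_tripleP T.
have [a' [_ a'0 sumA prodA]] := gm_triple_vieta (gm_triple_rot T).
case: T => [[k0 ka0 kb0 sE] [n0 a0 b0] E].
(* The cusps are [(a, b')] and [(b, c)]; [wE] and [yE] say that n times the vector is q times the
   first plus p times the second. *)
pose t := s * n - k; pose c := a + kb * n.
have wE : a * q + b * p = n * w.
  apply: (mulfI (x := n)); first by rewrite gt_eqF.
  transitivity (a * (n * q) + b * (n * p)); first by ring.
  rewrite qE pE; transitivity ((b * b' - a ^+ 2 - kb * n * a) * w); first by ring.
  by rewrite prodE; ring.
have yE : b' * q + c * p = n * y.
  apply: (mulfI (x := n)); first by rewrite gt_eqF.
  transitivity (b' * (n * q) + c * (n * p)); first by ring.
  rewrite qE pE /c; transitivity ((b * b' - a ^+ 2 - kb * n * a) * y); first by ring.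
  by rewrite prodE; ring.
have b'E : b' = t * a - ka * n - b by rewrite /t; lia.
have tmn : t * a * b = n ^+ 2 + a ^+ 2 + b ^+ 2 + ka * b * n + kb * n * a.
  by rewrite /t; lia.
have H : n ^+ 2 <= q ^+ 2 + p ^+ 2 + t * q * p.
  case: (ltgtP p 0) => // p_0; first by rewrite ltNge p0 in p_0.
    case: (ltgtP q 0) => // q_0; first by rewrite ltNge q0 in q_0.
      exact: (En q p w q_0 p_0 wE).
    have [x xE] : exists x, p = n * x.
      by apply: (coprimez_cancel nb); exists w; rewrite -wE q_0; ring.
    have x1 : 1 <= x by apply: (mul_gt0_ge1 n0); rewrite -xE.
    rewrite q_0 xE expr0n mulr0 mul0r addr0 add0r exprMn.
    by rewrite ler_peMr ?exprn_ege1 ?sqr_ge0.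
  have [x xE] : exists x, q = n * x.
    by apply: (coprimez_cancel na); exists w; rewrite -wE p_0; ring.
  have q1 : 0 < n * x.
    rewrite -xE lt_def q0 andbT; apply/eqP => q_0.
    by move: wE; rewrite q_0 p_0 !mulr0 addr0 => /esym/eqP; rewrite mulf_eq0 !gt_eqF.
  have x1 : 1 <= x by apply: (mul_gt0_ge1 n0).
  rewrite p_0 xE expr0n mulr0 !addr0 exprMn.
  by rewrite ler_peMr ?exprn_ege1 ?sqr_ge0.
rewrite -/t -(ler_pM2l (x := n ^+ 2)) ?exprn_gt0 //.
have -> : n ^+ 2 * (t * w * y - w ^+ 2 - y ^+ 2) =
    t * (n * w) * (n * y) - (n * w) ^+ 2 - (n * y) ^+ 2 by ring.
rewrite -wE -yE.
(* The identity holds modulo the Markov equation [tmn]. The Vieta partners [a'] and [b'] make the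
   extra coefficients visibly nonnegative. *)
have -> : t * (a * q + b * p) * (b' * q + c * p) - (a * q + b * p) ^+ 2 -
    (b' * q + c * p) ^+ 2 =
    n ^+ 2 * (q ^+ 2 + p ^+ 2 + t * q * p) +
    (n * (ka * b' + kb * a) * q ^+ 2 + n * (ka * b + kb * a') * p ^+ 2 +
     2 * n * (ka * a + kb * (b + ka * n)) * (q * p)).
  have a'E : a' = t * b - kb * n - a by rewrite /t; lia.
  apply/eqP; rewrite -subr_eq0; apply/eqP; rewrite /c a'E b'E.
  transitivity ((t * a * b - (n ^+ 2 + a ^+ 2 + b ^+ 2 + ka * b * n + kb * n * a)) *
    (p ^+ 2 + q ^+ 2 + t * p * q)); first by ring.
  by rewrite tmn subrr mul0r.
rewrite -[leLHS]addr0 lerD //.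
  by rewrite ler_pM2l ?exprn_gt0.
have ka1 := mulr_ge0 ka0; have kb1 := mulr_ge0 kb0.
have n1 := ltW n0; have a1 := ltW a0; have b1 := ltW b0.
have a'1 := ltW a'0; have b'1 := ltW b'0.
apply: addr_ge0; first apply: addr_ge0; apply: mulr_ge0; rewrite ?sqr_ge0 ?mulr_ge0 //.
- by rewrite addr_ge0 // mulr_ge0.
- by rewrite addr_ge0 // mulr_ge0.
- by rewrite addr_ge0 // mulr_ge0 // addr_ge0 // mulr_ge0.
Qed.

Lemma gm_trace_ge (s k ka kb n a b : int) :
  gm_triple s k ka kb n a b -> 3 * n <= s * n - k.
Proof.
case=> [[k0 ka0 kb0 sE] [n0 a0 b0] _].
have h1 : (3 + k) * n <= s * n by rewrite ler_wpM2r ?(ltW n0) // sE; lia.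
have h2 : 0 <= k * (n - 1) by rewrite mulr_ge0 // subr_ge0.
lia.
Qed.

(* Beyond the cusp (a, b') one application of the automorph (w, y) -> (t w - y, w)
   leads to the polygon glued to the edge a. *)
Lemma reduced_negative_bound (s k ka kb n a b w y r : int) :
  gm_triple s k ka kb n a b -> a <= n -> b <= n ->
  0 < w -> 2 * y <= (s * n - k) * w -> 0 <= r -> b * y - a * w = n * r ->
  n ^+ 2 <= (s * n - k) * w * y - w ^+ 2 - y ^+ 2.
Proof.
move=> T an bn w0 yw r0 rE.
have [[na nb _] _ _] := good_tripleP T.
have [b' [_ b'0 sumE prodE]] := gm_triple_vieta (gm_triple_rot (gm_triple_rot T)).
have t3 := gm_trace_ge T.
(* By direction, the vector lies in the polygon glued to b, in the cone of [opposite_edge_bound], or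
   beyond that cone. *)
have [rk|kr] := lerP r (kb * w).
  by apply: (polygon_bound T an bn w0 r0 rk); rewrite -rE; ring.
have [ayw|yaw] := lerP (a * y) (b' * w).
  have [p pE] : exists p, b' * w - a * y = n * p.
    apply: (coprimez_cancel nb); exists (n * w + kb * a * w - a * r).
    transitivity (b * b' * w - a * (b * y)); first by ring.
    have -> : b * y = n * r + a * w by rewrite -rE; ring.
    by rewrite prodE; ring.
  have p0 : 0 <= p.
    by case: T => [_ [n0 _ _] _]; rewrite -(pmulr_rge0 _ n0) -pE subr_ge0.
  have q0 : 0 <= r - kb * w by rewrite subr_ge0 ltW.
  apply: (opposite_edge_bound T b'0 sumE prodE w0 p0 q0); last by rewrite -pE.
  by rewrite mulrBr -rE; ring.
have [[k0 ka0 kb0 sE] [n0 a0 b0] E] := T.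
pose t := s * n - k; rewrite -/t in yw t3.
have [q qE] : exists q, a * (t * w - y) - b * w = n * q.
  apply: (coprimez_cancel nb); exists ((n + ka * b + kb * a) * w - a * r).
  have -> : n * ((n + ka * b + kb * a) * w - a * r) =
      (n ^+ 2 + ka * b * n + kb * n * a) * w - a * (n * r) by ring.
  have -> : n ^+ 2 + ka * b * n + kb * n * a =
      s * n * a * b - k * a * b - a ^+ 2 - b ^+ 2 by rewrite -E; ring.
  by rewrite -rE /t; ring.
(* The reduction [2 * y <= t * w] makes [a * (t * w - y)] at least half of [a * t * w], and
   [t >= 3 * n >= 3 * b]. *)
have q0 : 0 <= q.
  rewrite -(pmulr_rge0 _ n0) -qE.
  have h1 : a * (t * w) <= a * (2 * (t * w - y)).
    by rewrite ler_wpM2l ?(ltW a0) //; clear -yw; lia.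
  have h2 : 1 * t <= a * t.
    by rewrite ler_wpM2r //; clear -t3 n0; lia.
  have h3 : 2 * b * w <= a * t * w.
    by rewrite ler_wpM2r ?(ltW w0) //; clear -h2 t3 bn b0; lia.
  by clear -h1 h3; lia.
have qk : q <= ka * w.
  rewrite -(ler_pM2l n0) -qE ltW //.
  have b'E : b' = t * a - ka * n - b.
    by rewrite -(addrK b b') [b' + b]addrC sumE /t; ring.
  by rewrite b'E in yaw; clear -yaw; lia.
have qE' : a * (t * w - y) = n * q + b * w by rewrite -qE; ring.
have := polygon_bound (gm_triple_swap T) bn an w0 q0 qk qE'.
by rewrite -/t; clear; lia.
Qed.

(** The automorph of trace t, or its inverse, lowers [w + y] until [2 * y <= t * w] and
    [2 * w <= t * y]. The symmetry exchanging a and b then allows [r >= 0]. *)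
Lemma negative_bound (s k ka kb n a b w y r : int) :
  gm_triple s k ka kb n a b -> n = 1 \/ a <= n /\ b <= n ->
  0 < w -> 0 < y -> b * y - a * w = n * r ->
  w ^+ 2 + y ^+ 2 < (s * n - k) * w * y ->
  n ^+ 2 <= (s * n - k) * w * y - w ^+ 2 - y ^+ 2.
Proof.
move=> T [n1|[an bn]].
  by move=> _ _ _; rewrite n1 mulr1; clear; lia.
have [[na nb _] _ _] := good_tripleP T.
have [[k0 ka0 kb0 sE] [n0 a0 b0] E] := T.
pose t := s * n - k; rewrite -/t.
suff H (m : nat) : forall w y r : int, 0 < w -> 0 < y -> w + y <= m%:Z ->
    b * y - a * w = n * r -> w ^+ 2 + y ^+ 2 < t * w * y ->
    n ^+ 2 <= t * w * y - w ^+ 2 - y ^+ 2.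
  by move=> w0 y0; apply: (H (absz (w + y))) => //; clear -w0 y0; lia.
elim: m => [|m IH] {}w {}y {}r w0 y0 wym rE lt; first by clear -w0 y0 wym; lia.
(* Modulo n this reads [t * a * b = a ^ 2 + b ^ 2], whence the automorph preserves the lattice. *)
have eqn : n ^+ 2 + ka * b * n + kb * n * a =
    t * a * b - a ^+ 2 - b ^+ 2 by rewrite /t; clear -E; lia.
have [yw|wy] := lerP (2 * y) (t * w); last first.
  have tw : 0 < t * w - y.
    rewrite -(pmulr_lgt0 _ y0); have := sqr_ge0 w; have : 0 < w ^+ 2 by rewrite exprn_gt0.
    by clear -lt; lia.
  have [z zE] : exists z, b * w - a * (t * w - y) = n * z.
    apply: (coprimez_cancel nb); exists (a * r - (n + ka * b + kb * a) * w).
    have -> : n * (a * r - (n + ka * b + kb * a) * w) =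
      a * (n * r) - (n ^+ 2 + ka * b * n + kb * n * a) * w by ring.
    by rewrite eqn -rE; ring.
  have le : t * w - y + w <= m%:Z by clear -wy wym; lia.
  have := IH _ _ _ tw w0 le zE.
  have -> : (t * w - y) ^+ 2 + w ^+ 2 = t * (t * w - y) * w - (t * w * y - w ^+ 2 - y ^+ 2).
    by ring.
  by move=> H; rewrite [leRHS](_ : _ = t * (t * w - y) * w - (t * w - y) ^+ 2 - w ^+ 2);
    [apply: H; clear -lt; lia | ring].
have [wy|yw'] := lerP (2 * w) (t * y); last first.
  have ty : 0 < t * y - w.
    rewrite -(pmulr_lgt0 _ w0); have : 0 < y ^+ 2 by rewrite exprn_gt0.
    by have := sqr_ge0 w; clear -lt; lia.
  have [z zE] : exists z, b * (t * y - w) - a * y = n * z.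
    apply: (coprimez_cancel na); exists ((n + ka * b + kb * a) * y + b * r).
    have -> : n * ((n + ka * b + kb * a) * y + b * r) =
      (n ^+ 2 + ka * b * n + kb * n * a) * y + b * (n * r) by ring.
    by rewrite eqn -rE; ring.
  have le : y + (t * y - w) <= m%:Z by clear -yw' wym; lia.
  have := IH _ _ _ y0 ty le zE.
  have -> : y ^+ 2 + (t * y - w) ^+ 2 = t * y * (t * y - w) - (t * w * y - w ^+ 2 - y ^+ 2).
    by ring.
  by move=> H; rewrite [leRHS](_ : _ = t * y * (t * y - w) - y ^+ 2 - (t * y - w) ^+ 2);
    [apply: H; clear -lt; lia | ring].
have [r0|r0] := lerP 0 r.
  exact: (reduced_negative_bound T an bn w0 yw r0 rE).
have rE' : a * w - b * y = n * - r by rewrite mulrN -rE; ring.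
have := @reduced_negative_bound _ _ _ _ _ _ _ y w (- r) (gm_triple_swap T) bn an y0 wy.
by rewrite oppr_ge0 -/t => /(_ (ltW r0) rE'); clear; lia.
Qed.

(** * The minimum of the form on the lattice *)

(** For opposite signs of [w] and [y] this is [edge_bound], and on the axes the nonzero coordinate
    is a multiple of n. For equal signs and a nonnegative value, the automorph lowers [w + y] until
    the signs no longer agree; negative values are left to [negative_bound]. *)
Lemma lattice_bound (s k ka kb n a b w y r : int) :
  gm_triple s k ka kb n a b -> n = 1 \/ a <= n /\ b <= n ->
  (w, y) != (0, 0) -> b * y - a * w = n * r ->
  n ^+ 2 <= `|w ^+ 2 - (s * n - k) * w * y + y ^+ 2|.
Proof.
move=> T nmax.
have [[na nb _] [En _ _] _] := good_tripleP T.
have [[k0 ka0 kb0 sE] [n0 a0 b0] E] := T.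
have t3 := gm_trace_ge T.
pose t := s * n - k; rewrite -/t in t3 *.
have t2 : 2 <= t by clear -n0 t3; lia.
have eqn : n ^+ 2 + ka * b * n + kb * n * a =
    t * a * b - a ^+ 2 - b ^+ 2 by rewrite /t; clear -E; lia.
have axis c d : coprimez n c -> d != 0 -> (exists x, c * d = n * x) -> n ^+ 2 <= d ^+ 2.
  move=> nc dn0 /(coprimez_cancel nc) [x xE].
  have x0 : x != 0 by apply: contraNneq dn0 => x0; rewrite xE x0 mulr0.
  rewrite xE exprMn ler_peMr ?sqr_ge0 //.
  by have : 0 < x ^+ 2 by rewrite lt_def sqr_ge0 sqrf_eq0 x0.
have quadrant w' y' r' : 0 <= w' -> 0 <= y' -> (w', y') != (0, 0) ->
    a * w' + b * y' = n * r' -> n ^+ 2 <= w' ^+ 2 + t * w' * y' + y' ^+ 2.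
  move=> w0 y0 nz rE.
  have [w_0|wn0] := eqVneq w' 0.
    rewrite w_0 expr0n mulr0 mul0r !add0r; apply: (axis b) => //.
      by move: nz; rewrite w_0 xpair_eqE eqxx.
    by exists r'; rewrite -rE w_0; ring.
  have [y_0|yn0] := eqVneq y' 0.
    rewrite y_0 expr0n mulr0 !addr0; apply: (axis a) => //.
    by exists r'; rewrite -rE y_0; ring.
  rewrite [leRHS](_ : _ = w' ^+ 2 + y' ^+ 2 + t * w' * y'); last by ring.
  by apply: (En w' y' r') => //; rewrite lt_def ?wn0 ?yn0.
have pos (m : nat) : forall w y r : int, 0 < w -> 0 < y -> w + y <= m%:Z ->
    b * y - a * w = n * r -> t * w * y <= w ^+ 2 + y ^+ 2 ->
    n ^+ 2 <= w ^+ 2 - t * w * y + y ^+ 2.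
  elim: m => [|m IH] {}w {}y {}r w0 y0 wym rE ge; first by clear -w0 y0 wym; lia.
  have [wy|yw] := lerP w y.
    have [z zE] : exists z, b * w - a * (t * w - y) = n * z.
      apply: (coprimez_cancel nb); exists (a * r - (n + ka * b + kb * a) * w).
      have -> : n * (a * r - (n + ka * b + kb * a) * w) =
        a * (n * r) - (n ^+ 2 + ka * b * n + kb * n * a) * w by ring.
      by rewrite eqn -rE; ring.
    have GE : w ^+ 2 - t * w * y + y ^+ 2 =
      (t * w - y) ^+ 2 - t * (t * w - y) * w + w ^+ 2 by ring.
    have [tw|tw] := lerP (t * w - y) 0.
      rewrite GE [leRHS](_ : _ = (- (t * w - y)) ^+ 2 + t * (- (t * w - y)) * w + w ^+ 2);
        last by ring.
      apply: (quadrant _ _ z); rewrite ?oppr_ge0 ?(ltW w0) //.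
        by rewrite xpair_eqE negb_and (gt_eqF w0) orbT.
      by rewrite -zE; ring.
    rewrite GE; apply: (IH _ _ z) => //; last first.
      by clear -ge; lia.
    have lt2 : t * w < 2 * y.
      apply: edge_descent_lt => //; last by clear -ge; lia.
      rewrite lt_neqAle wy andbT; apply/eqP => eq_wy; rewrite -eq_wy in ge.
      have : t * w ^+ 2 <= 2 * w ^+ 2 by clear -ge; lia.
      by rewrite ler_pM2r ?exprn_gt0 //; clear -n0 t3; lia.
    by clear -lt2 wym; lia.
  have [z zE] : exists z, b * (t * y - w) - a * y = n * z.
    apply: (coprimez_cancel na); exists ((n + ka * b + kb * a) * y + b * r).
    have -> : n * ((n + ka * b + kb * a) * y + b * r) =
      (n ^+ 2 + ka * b * n + kb * n * a) * y + b * (n * r) by ring.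
    by rewrite eqn -rE; ring.
  have GE : w ^+ 2 - t * w * y + y ^+ 2 =
    y ^+ 2 - t * y * (t * y - w) + (t * y - w) ^+ 2 by ring.
  have [ty|ty] := lerP (t * y - w) 0.
    rewrite GE [leRHS](_ : _ = y ^+ 2 + t * y * (- (t * y - w)) + (- (t * y - w)) ^+ 2);
      last by ring.
    apply: (quadrant _ _ (- z)); rewrite ?oppr_ge0 ?(ltW y0) //.
      by rewrite xpair_eqE negb_and (gt_eqF y0).
    by transitivity (- (n * z)); [rewrite -zE|]; ring.
  rewrite GE; apply: (IH _ _ z) => //; last first.
    by clear -ge; lia.
  have lt2 : t * y < 2 * w.
    by apply: edge_descent_lt => //; clear -ge; lia.
  by clear -lt2 wym; lia.
suff main w' y' r' : 0 <= w' -> (w', y') != (0, 0) -> b * y' - a * w' = n * r' ->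
    n ^+ 2 <= `|w' ^+ 2 - t * w' * y' + y' ^+ 2|.
  move=> nz rE; have [w0|w0] := lerP 0 w; first exact: (main w y r).
  rewrite [X in `|X|](_ : _ = (- w) ^+ 2 - t * (- w) * (- y) + (- y) ^+ 2); last by ring.
  apply: (main _ _ (- r)); rewrite ?oppr_ge0 ?(ltW w0) //.
    by move: nz; rewrite !xpair_eqE !oppr_eq0.
  by transitivity (- (n * r)); [rewrite -rE|]; ring.
move=> w0 nz rE.
have [y0|y0] := lerP y' 0.
  apply: le_trans (ler_norm _).
  rewrite [leRHS](_ : _ = w' ^+ 2 + t * w' * (- y') + (- y') ^+ 2); last by ring.
  apply: (quadrant _ _ (- r')); rewrite ?oppr_ge0 //.
    by move: nz; rewrite !xpair_eqE !oppr_eq0.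
  by transitivity (- (n * r')); [rewrite -rE|]; ring.
have [w_0|wn0] := eqVneq w' 0.
  rewrite w_0 expr0n mulr0 mul0r subr0 add0r ger0_norm ?sqr_ge0 //.
  apply: (axis b) => //; first by rewrite gt_eqF.
  by exists r'; rewrite -rE w_0; ring.
have {}w0 : 0 < w' by rewrite lt_def wn0.
have [ge|lt] := lerP (t * w' * y') (w' ^+ 2 + y' ^+ 2).
  apply: le_trans (ler_norm _); apply: (pos (absz (w' + y')) _ _ r') => //.
  by clear -w0 y0; lia.
rewrite -normrN; apply: le_trans (ler_norm _).
have := negative_bound T nmax w0 y0 rE lt.
by rewrite -/t; clear; lia.
Qed.

(** * Lagrange and Markov constants from norm bounds *)

(** With D the difference of the roots and d the error of p against [q * alpha], the second factor
    of the norm is at most [d + q * D]. So norms at least 1 bound the terms by [D + 1 / q]. A vector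
    of norm 1 with [d > 0] has [q * d * D <= d * (d + q * D) = 1], hence gives a term at least D. *)
Lemma lagrange_constE (R : realType) (alpha alpha' : R) :
  alpha' < alpha ->
  (forall p q : int, (p, q) != (0, 0) ->
     1 <= `|(p%:~R - alpha * q%:~R) * (p%:~R - alpha' * q%:~R)|) ->
  (forall N : nat, exists (p : int) (q : nat), [/\ (N <= q)%N, (0 < q)%N,
     0 < p%:~R - alpha * q%:R &
     (p%:~R - alpha * q%:R) * (p%:~R - alpha' * q%:R) = 1]) ->
  lagrange_const alpha = (alpha - alpha')%:E.
Proof.
move=> lt_aa norm_ge1 norm_eq1.
set D := alpha - alpha'; have D0 : 0 < D by rewrite subr_gt0.
have dist_lb (q : nat) : (0 < q)%N ->
    (1 + q%:R * D)^-1 <= dist_int (q%:R * alpha).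
  move=> q0; have qR0 : 0 < q%:R :> R by rewrite ltr0n.
  have den0 : 0 < 1 + q%:R * D by rewrite addr_gt0 // mulr_gt0.
  apply: lb_le_inf; first by exists `|q%:R * alpha - 0%:~R|; exists 0.
  move=> _ [m _ <-]; set d := `|_|.
  have [d1|d1] := lerP 1 d.
    by apply: le_trans d1; rewrite invf_le1 // lerDl mulr_ge0 // ltW.
  have nz : (m, q%:Z) != (0, 0) by rewrite xpair_eqE negb_and; lia.
  have := norm_ge1 m q%:Z nz; rewrite normrM -pmulrn.
  have -> : `|m%:~R - alpha * q%:R| = d by rewrite /d distrC mulrC.
  move=> le1; rewrite -(ler_pM2r den0) mulVf ?gt_eqF //.
  apply: (le_trans le1); apply: ler_wpM2l; first exact: normr_ge0.
  have -> : m%:~R - alpha' * q%:R = (m%:~R - alpha * q%:R) + q%:R * D.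
    by rewrite /D; ring.
  rewrite (le_trans (ler_normD _ _)) // (ger0_norm (x := _ * D)).
    by rewrite lerD2r distrC [alpha * _]mulrC ltW.
  by rewrite mulr_ge0 // ltW.
apply/eqP; rewrite eq_le; apply/andP; split.
  apply/lee_addgt0Pr => e e0.
  have [N Ne] : exists N : nat, e^-1 < N%:R.
    by exists (Num.bound e^-1); rewrite archi_boundP // invr_ge0 ltW.
  apply: (@le_trans _ _ (ereal_sup
    ((fun q : nat => (q%:R * dist_int (q%:R * alpha))^-1%:E) @` [set q | (N.+1 <= q)%N]))).
    by apply: ereal_inf_lbound; exists [set q | (N.+1 <= q)%N] => //; exists N.+1.
  apply: ge_ereal_sup => _ [q /= Nq <-].
  have q0 : (0 < q)%N by apply: leq_trans Nq.
  have qR0 : 0 < q%:R :> R by rewrite ltr0n.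
  have den0 : 0 < 1 + q%:R * D by rewrite addr_gt0 // mulr_gt0.
  rewrite -EFinD lee_fin.
  have h1 : q%:R / (1 + q%:R * D) <= q%:R * dist_int (q%:R * alpha).
    by rewrite ler_wpM2l ?dist_lb // ltW.
  have h0 : 0 < q%:R / (1 + q%:R * D) by rewrite divr_gt0.
  apply: (@le_trans _ _ (q%:R / (1 + q%:R * D))^-1).
    by rewrite lef_pV2 // posrE // (lt_le_trans h0).
  rewrite invf_div mulrDl mul1r addrC mulrAC divff ?gt_eqF // mul1r lerD2l.
  rewrite -[e]invrK lef_pV2 ?posrE ?invr_gt0 //.
  by apply: ltW; apply: (lt_le_trans Ne); rewrite ler_nat ltnW.
apply/ereal_infP => _ [V [N _ NV] <-].
have [p [q [Nq q0 d0 dE]]] := norm_eq1 N.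
apply: (@le_trans _ _ (q%:R * dist_int (q%:R * alpha))^-1%:E); last first.
  by apply: ereal_sup_ubound; exists q => //; apply: NV.
have qR0 : 0 < q%:R :> R by rewrite ltr0n.
have den0 : 0 < 1 + q%:R * D by rewrite addr_gt0 // mulr_gt0.
have dist0 : 0 < dist_int (q%:R * alpha).
  by apply: lt_le_trans (dist_lb q q0); rewrite invr_gt0.
rewrite lee_fin -[D]invrK lef_pV2 ?posrE ?invr_gt0 ?mulr_gt0 //.
set d := _ - _ in d0 dE.
have dist_le : dist_int (q%:R * alpha) <= d.
  have -> : d = `|q%:R * alpha - p%:~R|.
    by rewrite distrC [_ * alpha]mulrC -/d gtr0_norm.
  by apply: ge_inf; [exists 0 => _ [m _ <-] | exists p].
rewrite -(ler_pM2r D0) mulVf ?gt_eqF // -[leRHS]dE.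
have -> : p%:~R - alpha' * q%:R = d + q%:R * D by rewrite /d /D; ring.
apply: (@le_trans _ _ (q%:R * d * D)).
  by rewrite ler_pM2r // ler_pM2l.
have -> : q%:R * d * D = d * (q%:R * D) by ring.
by rewrite [leRHS]mulrDr lerDr -expr2 sqr_ge0.
Qed.

Lemma markov_constE (R : realType) (alpha alpha' : R) :
  alpha' < alpha ->
  (forall p q : int, (p, q) != (0, 0) ->
     1 <= `|(p%:~R - alpha * q%:~R) * (p%:~R - alpha' * q%:~R)|) ->
  markov_const (BQForm 1 (- (alpha + alpha')) (alpha * alpha')) =
    (alpha - alpha')%:E.
Proof.
move=> lt_aa norm_ge1; set D := alpha - alpha'.
have D0 : 0 <= D by rewrite subr_ge0 ltW.
have evalE x y : qeval (BQForm 1 (- (alpha + alpha')) (alpha * alpha')) x y =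
    (x - alpha * y) * (x - alpha' * y) by rewrite /qeval /=; ring.
rewrite /markov_const.
have -> : Num.sqrt (qdisc (BQForm 1 (- (alpha + alpha')) (alpha * alpha'))) = D.
  have -> : qdisc (BQForm 1 (- (alpha + alpha')) (alpha * alpha')) = D ^+ 2.
    by rewrite /qdisc /D /=; ring.
  by rewrite sqrtr_sqr ger0_norm.
(* The values of the form are nonzero, so the division in the extended reals is the real one. *)
have termE (v : R) : 1 <= `|v| -> (D%:E / `|v|%:E)%E = (D / `|v|)%:E.
  by move=> v1; rewrite inver gt_eqF // (lt_le_trans _ v1).
apply/eqP; rewrite eq_le; apply/andP; split.
  apply: ge_ereal_sup => _ [[p q] /= nz <-]; have v1 := norm_ge1 p q nz.
  rewrite evalE termE // lee_fin ler_pdivrMr ?(lt_le_trans ltr01) //.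
  by rewrite ler_peMr.
apply: ereal_sup_ubound; exists (1, 0) => //=.
by rewrite evalE !mulr0 !subr0 mulr1 termE normr1 ?divr1.
Qed.

(** * From a triple to a quadratic irrational *)

Lemma gm_form (s k ka kb n a b : int) :
  gm_triple s k ka kb n a b -> n = 1 \/ a <= n /\ b <= n ->
  exists u c : int, n * c = u ^+ 2 - (s * n - k) * u + 1 /\
    forall x y : int, (x, y) != (0, 0) ->
      n <= `|n * x ^+ 2 + (s * n - k - 2 * u) * x * y + c * y ^+ 2|.
Proof.
move=> T nmax; have [[na _ _] _ _] := good_tripleP T.
have [n' [_ _ _ prodE]] := gm_triple_vieta T.
have [_ [n0 a0 b0] _] := T.
have [i [j ijE]] := Bezoutz n a.
rewrite (eqP na : gcdz n a = 1) in ijE.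
pose u := b * j; pose e := b * i.
have uE : a * u = b - n * e.
  rewrite /u /e; transitivity (b * (i * n + j * a) - n * (b * i)); first by ring.
  by rewrite ijE mulr1.
(* Modulo n the product [a * u] is b, so [a ^ 2] times the left-hand side is
   [b ^ 2 + k * a * b + a ^ 2 = n * n']. *)
have [c cE] : exists c, u ^+ 2 - (s * n - k) * u + 1 = n * c.
  do 2 apply: (coprimez_cancel na).
  exists (n' - 2 * b * e + n * e ^+ 2 - k * a * e - s * a ^+ 2 * u).
  transitivity ((a * u) ^+ 2 + k * a * (a * u) + a ^+ 2 - n * s * a ^+ 2 * u).
    by ring.
  transitivity (n * n' + n * (- 2 * b * e + n * e ^+ 2 - k * a * e - s * a ^+ 2 * u)).
    by rewrite uE prodE; ring.
  by ring.
exists u, c; split=> // x y nz.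
have nz' : (u * y - n * x, y) != (0, 0).
  move: nz; rewrite !xpair_eqE; apply: contraNN => /andP[/eqP wE /eqP yE].
  by move: wE; rewrite yE mulr0 sub0r => /eqP; rewrite oppr_eq0 mulf_eq0 gt_eqF //= eqxx andbT.
have rE : b * y - a * (u * y - n * x) = n * (e * y + a * x).
  transitivity (b * y - a * u * y + n * a * x); first by ring.
  by rewrite uE; ring.
have lb := lattice_bound T nmax nz' rE.
rewrite -(ler_pM2l n0) -expr2; set f := _ + c * _.
have -> : n * `|f| = `|n * f| by rewrite normrM (gtr0_norm n0).
have -> // : n * f = (u * y - n * x) ^+ 2 - (s * n - k) * (u * y - n * x) * y + y ^+ 2.
rewrite /f !mulrDr [n * (c * _)]mulrA -cE; ring.
Qed.

(** The pairs [(v, w)] are consecutive terms of the recurrence with characteristic roots e and e'.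
    Each step multiplies the two factors by e' and e, so positivity and the product persist. *)
Lemma unit_orbit (R : realType) (t : int) (e e' : R) :
  3 <= t -> 0 < e' -> e * e' = 1 -> e + e' = t%:~R -> forall N : nat,
  exists v w : int, [/\ 0 <= v, v < w, N%:Z < w, 0 < w%:~R * e' - v%:~R &
    (w%:~R * e' - v%:~R) * (w%:~R * e - v%:~R) = 1].
Proof.
move=> t3 e'0 eM eD; elim=> [|N [v [w [v0 vw Nw pos norm1]]]].
  by exists 0, 1; split; rewrite ?mul1r ?subr0 // mulrC.
have step x y : x + y = t%:~R -> y * x = 1 ->
    (t * w - v)%:~R * x - w%:~R = x * (w%:~R * x - v%:~R) :> R.
  move=> xy yx; rewrite intrB intrM -xy.
  by transitivity (x * (w%:~R * x - v%:~R) + w%:~R * (y * x - 1)); [ring|rewrite yx; ring].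
have tw : 3 * w <= t * w by rewrite ler_wpM2r //; lia.
exists w, (t * w - v); split; try lia.
  by rewrite (step _ e) ?mulr_gt0 // addrC.
rewrite (step _ e) // 1?addrC // (step _ e') // 1?mulrC //.
by transitivity (e * e' * ((w%:~R * e' - v%:~R) * (w%:~R * e - v%:~R)));
  [ring | rewrite eM norm1 mulr1].
Qed.

Lemma map_monic_quadratic (F K : nzRingType) (f : {rmorphism F -> K}) (x y : F) :
  map_poly f ('X ^+ 2 - x%:P * 'X + y%:P) =
  'X ^+ 2 - (f x)%:P * 'X + (f y)%:P.
Proof. by rewrite rmorphD rmorphB rmorphXn rmorphM /= map_polyX !map_polyC. Qed.

Lemma form_spectrum (R : realType) (n : nat) (t u c : int) :
  (0 < n)%N -> 3 <= t -> n%:Z * c = u ^+ 2 - t * u + 1 ->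
  (forall x y : int, (x, y) != (0, 0) ->
     n%:Z <= `|n%:Z * x ^+ 2 + (t - 2 * u) * x * y + c * y ^+ 2|) ->
  exists (alpha alpha' : R) (Q : bqform R),
    [/\ quadratic_irrational alpha, Qsqrt (t ^+ 2 - 4) alpha,
        quadratic_conjugate alpha alpha' &
        [/\ forall x y : R, qeval Q x y = (x - alpha * y) * (x - alpha' * y),
            indefinite Q,
            lagrange_const alpha = markov_const Q &
            markov_const Q = (Num.sqrt (t ^+ 2 - 4)%:~R / n%:R)%:E]].
Proof.
move=> n0 t3 cE form_ge.
pose S : R := Num.sqrt (t ^+ 2 - 4)%:~R.
have nR0 : 0 < n%:R :> R by rewrite ltr0n.
have nRn0 : n%:R != 0 :> R by rewrite gt_eqF.
have D0 : 0 < t ^+ 2 - 4.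
  by have : 0 <= (t - 3) * t by [rewrite mulr_ge0 //; lia]; lia.
have S0 : 0 < S by rewrite sqrtr_gt0 ltr0z.
have S2 : S ^+ 2 = t%:~R ^+ 2 - 4.
  by rewrite sqr_sqrtr ?ler0z ?ltW // intrB rmorphXn.
have cR : n%:R * c%:~R = u%:~R ^+ 2 - t%:~R * u%:~R + 1 :> R.
  by have := congr1 (intr : int -> R) cE; rewrite intrD intrB rmorphXn !intrM -pmulrn.
(* These are the roots of [n X^2 + (t - 2 u) X + c], so the integral form is n times the norm. *)
pose alpha : R := (2 * u%:~R - t%:~R + S) / (2 * n%:R).
pose alpha' : R := (2 * u%:~R - t%:~R - S) / (2 * n%:R).
have aD : alpha - alpha' = S / n%:R by rewrite /alpha /alpha'; field.
have lt_aa : alpha' < alpha by rewrite -subr_gt0 aD divr_gt0.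
have sumE : alpha + alpha' = (2 * u%:~R - t%:~R) / n%:R.
  by rewrite /alpha /alpha'; field.
have prodE : alpha * alpha' = c%:~R / n%:R.
  have -> : alpha * alpha' =
      ((2 * u%:~R - t%:~R) ^+ 2 - S ^+ 2) / (4 * n%:R ^+ 2).
    by rewrite /alpha /alpha'; field.
  rewrite S2; have -> : (2 * u%:~R - t%:~R) ^+ 2 - (t%:~R ^+ 2 - 4) =
      4 * (n%:R * c%:~R) :> R by rewrite cR; ring.
  by field.
have norm_ge1 (p q : int) : (p, q) != (0, 0) ->
    1 <= `|(p%:~R - alpha * q%:~R) * (p%:~R - alpha' * q%:~R)|.
  move=> nz; rewrite -(ler_pM2l nR0) mulr1 -{2}(gtr0_norm nR0) -normrM.
  have -> : n%:R * ((p%:~R - alpha * q%:~R) * (p%:~R - alpha' * q%:~R)) =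
      (n%:Z * p ^+ 2 + (t - 2 * u) * p * q + c * q ^+ 2)%:~R.
    transitivity (n%:R * (p%:~R ^+ 2 - (alpha + alpha') * p%:~R * q%:~R +
      alpha * alpha' * q%:~R ^+ 2)); first by ring.
    rewrite sumE prodE !intrD ![(_ * _ ^+ 2)%:~R]intrM !rmorphXn !intrM intrB intrM -pmulrn /=.
    by field.
  by rewrite -intr_norm pmulrn ler_int form_ge.
(* At a rational root the norm would vanish on the vector of its numerator and denominator. *)
have not_rat x : (exists y, x = ratr y :> R) -> x != alpha /\ x != alpha'.
  move=> [y ->].
  have nz : (numq y, denq y) != (0, 0) by rewrite xpair_eqE denq_eq0 andbF.
  have := norm_ge1 _ _ nz.
  have dn0 : (denq y)%:~R != 0 :> R by rewrite intr_eq0 denq_eq0.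
  have yE : (numq y)%:~R = ratr y * (denq y)%:~R :> R by rewrite /ratr divfK.
  rewrite yE -!mulrBl !normrM => ge1.
  by split; apply: contraTneq ge1 => ->;
    rewrite subrr normr0 ?mul0r ?mulr0 -ltNge ltr01.
pose p : {poly rat} := 'X ^+ 2 - ((2 * u - t)%:Q / n%:Q)%:P * 'X + (c%:Q / n%:Q)%:P.
have pE : map_poly ratr p = ('X - alpha%:P) * ('X - alpha'%:P).
  rewrite /p (map_monic_quadratic (ratr : {rmorphism rat -> R})).
  rewrite [X in _ - X%:P * _](_ : _ = alpha + alpha'); last first.
    by rewrite sumE [LHS]fmorph_div !rmorph_int -pmulrn intrB intrM.
  rewrite [X in _ + X%:P](_ : _ = alpha * alpha'); last first.
    by rewrite prodE [LHS]fmorph_div !rmorph_int -pmulrn.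
  rewrite [(alpha + _)%:P]polyCD [(alpha * _)%:P]polyCM.
  by move: alpha%:P alpha'%:P => A A'; ring.
have size_p : size p = 3%N.
  by rewrite -(size_map_poly (ratr : {rmorphism rat -> R})) pE size_Mmonic
    ?polyXsubC_eq0 ?monicXsubC // !size_XsubC.
exists alpha, alpha', (BQForm 1 (- (alpha + alpha')) (alpha * alpha')).
have rootE x : root (map_poly ratr p) x = (x == alpha) || (x == alpha').
  by rewrite pE rootM !root_XsubC.
split.
- split; last by exists p; rewrite // rootE eqxx.
  by move=> [y _ yE]; have [] := not_rat alpha; [exists y | rewrite eqxx].
- exists ((2 * u - t)%:Q / (2 * n%:Z)%:Q), (1 / (2 * n%:Z)%:Q).
  rewrite !fmorph_div !rmorph_int /= rmorph1 -/S /alpha intrB !intrM -!pmulrn.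
  by field.
- exists p => //; apply: cubic_irreducible; first by rewrite size_p.
  move=> y; rewrite -(fmorph_root (ratr : {rmorphism rat -> R})) rootE negb_or.
  by apply/andP; apply: not_rat; exists y.
have MQ := markov_constE lt_aa norm_ge1.
split.
- by move=> x y; rewrite /qeval /=; ring.
- rewrite /indefinite /qdisc /= [ltRHS](_ : _ = (alpha - alpha') ^+ 2); last by ring.
  by rewrite exprn_gt0 // subr_gt0.
- rewrite MQ; apply: lagrange_constE => // N.
  have [||| v [w [v0 vw Nw pos norm1]]] :=
      @unit_orbit R t ((t%:~R + S) / 2) ((t%:~R - S) / 2) t3 _ _ _ N.
  + rewrite divr_gt0 // subr_gt0 -(ltr_pXn2r (n := 2)) ?nnegrE ?(ltW S0) //.
      by rewrite S2 ltrBlDr ltrDl.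
    by rewrite ler0z; lia.
  + by transitivity ((t%:~R ^+ 2 - S ^+ 2) / 4 : R); [field | rewrite S2; field].
  + by field.
  have w0 : 0 < w by apply: le_lt_trans vw.
  have wE : (absz w)%:R = w%:~R :> R by rewrite pmulrn gtz0_abs.
  have e1 : (u * w - v)%:~R - alpha * (n * absz w)%:R =
      w%:~R * ((t%:~R - S) / 2) - v%:~R.
    by rewrite natrM wE intrB intrM /alpha; field.
  have e2 : (u * w - v)%:~R - alpha' * (n * absz w)%:R =
      w%:~R * ((t%:~R + S) / 2) - v%:~R.
    by rewrite natrM wE intrB intrM /alpha'; field.
  (* With these witnesses the factors of the norm are [w * e' - v] and [w * e - v] for the units
     [(t - S) / 2] and [(t + S) / 2]. *)
  exists (u * w - v), (n * absz w)%N; rewrite e1 e2; split=> //.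
    by rewrite (leq_trans _ (leq_pmull _ n0)) //; lia.
  by rewrite muln_gt0 n0; lia.
- by rewrite MQ aD.
Qed.

Theorem theorem1p2 (R : realType) (k1 k2 k3 : nat) :
  [/\ forall (n : nat) (i : 'I_3), gmarkov_at k1 k2 k3 n i ->
        exists (alpha alpha' : R) (Q : bqform R),
          [/\ quadratic_irrational alpha,
              Qsqrt (Delta k1 k2 k3 n i) alpha,
              quadratic_conjugate alpha alpha' &
              [/\ forall x y : R,
                    qeval Q x y = (x - alpha * y) * (x - alpha' * y),
                  indefinite Q,
                  lagrange_const alpha = markov_const Q &
                  markov_const Q =
                    (Num.sqrt (Delta k1 k2 k3 n i)%:~R / n%:R)%:E]],
      EFin @` gmarkov_set R k1 k2 k3 `<=` lagrange_spectrum R &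
      EFin @` gmarkov_set R k1 k2 k3 `<=` markov_spectrum R].
Proof.
have main (n : nat) (i : 'I_3) : gmarkov_at k1 k2 k3 n i ->
    exists (alpha alpha' : R) (Q : bqform R),
      [/\ quadratic_irrational alpha, Qsqrt (Delta k1 k2 k3 n i) alpha,
          quadratic_conjugate alpha alpha' &
          [/\ forall x y : R, qeval Q x y = (x - alpha * y) * (x - alpha' * y),
              indefinite Q, lagrange_const alpha = markov_const Q &
              markov_const Q = (Num.sqrt (Delta k1 k2 k3 n i)%:~R / n%:R)%:E]].
  move=> [x [y [z [[x0 y0 z0 E] nE]]]].
  pose s := (3 + k1 + k2 + k3)%N%:Z.
  have T : gm_triple s k1%:Z k2%:Z k3%:Z x%:Z y%:Z z%:Z.
    by split; [split; rewrite /s; lia | split; lia | rewrite /s; lia].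
  have [ka [kb [a [b Ti]]]] : exists ka kb a b,
      gm_triple s (tnth [tuple k1; k2; k3] i)%:Z ka kb n%:Z a b.
    rewrite nE; case: i {nE} => [[|[|[|//]]] lt_i].
    - by exists k2%:Z, k3%:Z, y%:Z, z%:Z.
    - by exists k3%:Z, k1%:Z, z%:Z, x%:Z; apply: gm_triple_rot.
    - by exists k1%:Z, k2%:Z, x%:Z, y%:Z; do 2 apply: gm_triple_rot.
  (* The claim involves only n, s and the coefficient at position i, so the other two entries may be
     exchanged for smaller ones. *)
  have [a' [b' [T' nmax]]] := gm_triple_max Ti.
  have [u [c [cE form_ge]]] := gm_form T' nmax.
  have [_ [n0 _ _] _] := T'.
  have t3 := gm_trace_ge T'.
  by apply: (form_spectrum R _ _ cE form_ge); [rewrite -ltz_nat | lia].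
split=> //.
- move=> _ [v [n [i [at_i ->]]] <-].
  have [alpha [alpha' [Q [[irr _] _ _ [_ _ LM MQ]]]]] := main n i at_i.
  by exists alpha => //; rewrite LM MQ.
- move=> _ [v [n [i [at_i ->]]] <-].
  have [alpha [alpha' [Q [_ _ _ [_ ind _ MQ]]]]] := main n i at_i.
  by exists Q.
Qed.
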